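(* Let $\{Q_i\}_{i\in\bar\Lambda}$ be a complete set of key polynomials for $\nu$. Let $\ell\in\bar\Lambda$ be such that $\ell+\omega\in\bar\Lambda$ and $\alpha_{\ell+t}=1$ for all $t\in\mathbb N$. Put $h=Q_{\ell+\omega}$ and let $\delta$ be the stable value of $\delta_{\ell+t}(h)$ for $t$ sufficiently large. Assume that the sequence $\{\beta_{\ell+t}\}_{t\in\mathbb N}$ is unbounded in $\tilde\Gamma_0$. Then $\nu(h)\notin\tilde\Gamma_0$. If, in addition, $\operatorname{char}k_\nu=\operatorname{char}K$, $\ell=1$ and $\alpha_t=1$ for all $t\in\mathbb N$, then $h\in K[x^\delta]$; in particular $\partial_{b'}h=0$ for all integers $b'$ with $0<b'<\delta$.
   Context: Setting. $K\subset K(x)$ is a simple transcendental extension, $\nu$ a valuation of $K(x)$ with value group $\Gamma$ and residue field $k_\nu$, $\nu_K=\nu|_K$ with value group $\Gamma_0$; $\operatorname{rank}\nu_K=1$, $\nu(x)>0$. $\tilde\Gamma_0=\Gamma_0\otimes_{\mathbb Z}\mathbb Q$, with a fixed ordered embedding into $\mathbb R$; values are compared in $\Gamma\otimes\mathbb Q$. $\mathbb N$ = positive integers, $\mathbb N_0=\mathbb N\cup\{0\}$. $\partial_b$ is the $b$-th Hasse derivative: $f(x+y)=\sum_b\partial_bf(x)y^b$. $G_\nu=\bigoplus_{\beta\in\Gamma}\mathbf P_\beta/\mathbf P_{\beta+}$ with $\mathbf P_\beta=\{y\in K(x):\nu(y)\ge\beta\}$, $\mathbf P_{\beta+}=\{y:\nu(y)>\beta\}$;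 $\mathrm{in}_\nu y$ is the class of $y$ in degree $\nu(y)$; $G_{\nu_K}$ is the analogous algebra for $(K,\nu_K)$. For a graded domain $G$, $G^*=\{g/h: g,h\in G,\ h\ne0 \text{ homogeneous}\}$. Index sets. $\Lambda$ is a countable well ordered set with least element $0$; $i+1$ is the successor of $i$, etc. $(\alpha_i)_{i\in\Lambda}$ are positive integers, $\alpha_0=1$. $i$ is inessential if $i+\omega\in\Lambda$ and $\alpha_{i+t}=1$ for all $t\in\mathbb N_0$. For non-maximal $i$, $i+$ denotes $i+\omega$ if $i$ is inessential, and $i+1$ otherwise. Pre-key polynomials: monic $Q_i\in K[x]$ $(i\in\Lambda)$, $Q_0=x$, with $\deg Q_i=\alpha_i\deg Q_{i_0}$ for all non-maximal $i\ge1$ and $i_0<i$ with $i_0+=i$. Put $\beta_i=\nu(Q_i)$, $\bar\alpha_i=\deg_xQ_i$, $\mathbf Q_i=\{Q_q\}_{q<i}$. Standard expansions. An $\ell$-standard monomial is $c\prod_{i\le\ell}Q_i^{\gamma_i}$, $c\in K$, $\gamma_i\in\mathbb N_0$ almost all $0$, with $\gamma_i<\alpha_{i+}$ for $i<\ell$ and, for each inessential $i$, at most one $j$ with $j+=i+$ and $\gamma_j\neq0$ (here $i+$ is computed in $\{q\in\Lambda:q\le\ell\}$). It is $Q_\ell$-free if $\gamma_\ell=0$. A $Q_\ell$-free $\ell$-standard expansion is a finite sum of $Q_\ell$-free $\ell$-standard monomials whose $\nu$-value is the minimum of the values of the monomials. An $\ell$-standard expansion of $g\in K[x]$ is $g=\sum_jc_jQ_\ell^j$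 with each $c_j$ a $Q_\ell$-free $\ell$-standard expansion. Set of key polynomials for $\nu$: a set of pre-key polynomials such that (a) $\beta_i\in\tilde\Gamma_0$ for $i\ne\max\Lambda$; (b) if $i\ge1$ has an immediate predecessor, $Q_i$ has an $(i-1)$-standard expansion $Q_i=Q_{i-1}^{\alpha_i}+\sum_{j<\alpha_i}\big(\sum_\gamma c_{j,\gamma}M_\gamma\big)Q_{i-1}^j$ where the $c_{j,\gamma}M_\gamma$ are $Q_{i-1}$-free $(i-1)$-standard monomials ($c_{j,\gamma}\in K$, $M_\gamma$ a product of powers of elements of $\mathbf Q_{i-1}$; elements of $K$ if $i=1$), all the monomials appearing have the same $\nu$-value, and $(\mathrm{in}_\nu Q_{i-1})^{\alpha_i}+\sum_{j}\big(\sum_\gamma \mathrm{in}_{\nu_K}c_{j,\gamma}\,\mathrm{in}_\nu M_\gamma\big)(\mathrm{in}_\nu Q_{i-1})^j=0$ is the minimal algebraic relation of $\mathrm{in}_\nu Q_{i-1}$ over $G_{\nu_K}[\mathrm{in}_\nu\mathbf Q_{i-1}]^*$; (c) if $i\geq 1$ has no immediate predecessor, there is $i_0$ with $i_0+=i$, and for every such $i_0$ there is an $i_0$-standard expansion $Q_i=\sum_{j=0}^{\alpha_i}c_{j,i_0}Q_{i_0}^j$; every such expansion satisfies $\nu(Q_i)>\min_j\nu(c_{j,i_0}Q_{i_0}^j)$, and $Q_i$ has the smallest degree among polynomials with this property for all $i_0$ with $i_0+=i$; if $\{\beta_{i'}:i'<i\}$ is bounded in $\tilde\Gamma_0$ (in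 particular if $i\ne\max\Lambda$) then $c_{\alpha_i,i_0}=1$ and $\min_j\nu(c_{j,i_0}Q_{i_0}^j)=\alpha_i\beta_{i_0}=\nu(c_{0,i_0})$; (d) if for some $n$ the set $\{i:\deg Q_i=n\}$ is infinite, then $\{\nu(Q_i):\deg Q_i=n\}$ is cofinal in $\{\nu(f): f\in K[x]\text{ monic},\deg f=n\}$. Truncations. Each $f\in K[x]$ has a unique $Q_i$-expansion $f=\sum_jd_{j,i}Q_i^j$ with $\deg d_{j,i}<\deg Q_i$; put $\nu_i(f)=\min_j\{\nu(d_{j,i})+j\beta_i\}$. For $f\ne0$, $S_i(f)=\{j: d_{j,i}\neq 0,\ \nu(d_{j,i})+j\beta_i=\nu_i(f)\}$ and $\delta_i(f)=\max S_i(f)$; for $i=\ell+t$, $\delta_{\ell+t}(f)$ is eventually constant in $t$. A set of key polynomials is complete if for every nonzero $f\in K[x]$ there is $i\in\Lambda$ with $\nu_i(f)=\nu(f)$. *)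

(* Defs.v *)
From HB Require Import structures.
From mathcomp Require Import all_boot all_order all_algebra.
From mathcomp Require Import finmap.
From mathcomp Require Import boolp classical_sets cardinality.
From mathcomp Require wochoice.
From mathcomp Require Import -(notations) monalg.

Set Implicit Arguments.
Unset Strict Implicit.
Unset Printing Implicit Defensive.

Import Order.TTheory GRing.Theory.
Local Open Scope classical_set_scope.
Local Open Scope ring_scope.

(* A totally ordered Q-vector space, such as Gamma (x) Q for an ordered abelian
   group Gamma. *)
Record orderedQSpace := OrderedQSpace {
  oqs_base : lmodType rat;
  oqs_le : rel oqs_base;
  oqs_anti : antisymmetric oqs_le;
  oqs_trans : transitive oqs_le;
  oqs_total : total oqs_le;
  oqs_leD2r : forall z x y, oqs_le x y -> oqs_le (x + z) (y + z)
}.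

Definition values (V : orderedQSpace) : Type := oqs_base V.
Coercion values : orderedQSpace >-> Sortclass.

Section OrderedTheory.
Variable V : orderedQSpace.
Implicit Types x y z : V.

HB.instance Definition _ := GRing.Lmodule.on (values V).

Lemma oqs_refl : reflexive (@oqs_le V).
Proof. by move=> x; have := oqs_total x x; rewrite orbb. Qed.

HB.instance Definition _ := Order.Le_isPOrder.Build ring_display (values V)
  oqs_refl (@oqs_anti V) (@oqs_trans V).
HB.instance Definition _ := Order.POrder_isTotal.Build ring_display (values V)
  (@oqs_total V).

Lemma ord_leD2r z x y : x <= y -> x + z <= y + z.
Proof. exact: oqs_leD2r. Qed.

Lemma ord_leD x y z t : x <= y -> z <= t -> x + z <= y + t.
Proof.
move=> xy zt; apply: le_trans (ord_leD2r z xy) _.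
by rewrite ![y + _]addrC; apply: ord_leD2r.
Qed.

Lemma ord_ltD x y z t : x <= y -> z < t -> x + z < y + t.
Proof.
move=> xy zt; rewrite lt_neqAle ord_leD ?(ltW zt) // andbT.
apply: contraTneq zt => e; rewrite -leNgt.
have h : x + z <= y + z by apply: ord_leD2r.
have : y + t <= y + z by rewrite -e.
by rewrite ![y + _]addrC => /(ord_leD2r (- y)); rewrite !addrK.
Qed.

Lemma ord_addn x y : x + x = y + y -> x = y.
Proof.
wlog xy : x y / x <= y => [W|] e.
  by case: (leP x y) => [/W|/ltW /W W']; [exact | symmetry; apply: W'].
apply/eqP; rewrite eq_le xy /= leNgt; apply/negP => lt_xy.
by have := ord_ltD (ltW lt_xy) lt_xy; rewrite e ltxx.
Qed.
End OrderedTheory.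

(* The value [+oo] at 0 is not represented: [nu 0] is an arbitrary element,
   and every use of the valuation of an element that may be 0 is guarded. *)
Record valuation (L : fieldType) (V : orderedQSpace) := Valuation {
  val_fun :> L -> V;
  valuationM : forall x y, x != 0 -> y != 0 -> val_fun (x * y) = val_fun x + val_fun y;
  valuationD : forall x y, x != 0 -> y != 0 -> x + y != 0 ->
    Order.min (val_fun x) (val_fun y) <= val_fun (x + y)
}.

Section Valuations.
Variables (L : fieldType) (V : orderedQSpace) (nu : valuation L V).
Implicit Types (x y : L) (b : V).

Definition value_group : set V := [set nu y | y in [set y : L | y != 0]].

(* The Q-subspace of V spanned by the value group: value_group (x) Q. *)
Definition rational_hull : set V :=
  [set v | exists (q : rat) (g : V), value_group g /\ v = q *: g].

Definition convex_subgroup (H : set V) : Prop :=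
  [/\ H 0, (forall g h, H g -> H h -> H (g - h)), H `<=` value_group &
      forall g h, H h -> value_group g -> 0 <= g <= h -> H g].

(* The rank is the number of proper convex subgroups of the value group. *)
Definition rank_one : Prop :=
  value_group != [set 0] /\
  forall H, convex_subgroup H -> H = [set 0] \/ H = value_group.

(* The groups P_b and P_{b+}, with nu 0 = +oo. *)
Definition val_ge b : {pred L} := [pred y | (y == 0) || (b <= nu y)].
Definition val_gt b : {pred L} := [pred y | (y == 0) || (b < nu y)].

Lemma valuation1 : nu 1 = 0.
Proof.
have /eqP := valuationM nu (oner_neq0 L) (oner_neq0 L).
by rewrite mulr1 -subr_eq0 opprD addrA subrr add0r oppr_eq0 => /eqP.
Qed.

Lemma valuationN x : nu (- x) = nu x.
Proof.
have [->|nx] := eqVneq x 0; first by rewrite oppr0.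
have n1 : (-1 : L) != 0 by rewrite oppr_eq0 oner_neq0.
rewrite -mulN1r valuationM //.
have -> : nu (-1) = 0; last by rewrite add0r.
by apply: ord_addn; rewrite -valuationM // mulrNN mulr1 valuation1 addr0.
Qed.

Lemma val_geB b : {in val_ge b &, forall x y, x - y \in val_ge b}.
Proof.
move=> x y; rewrite !inE.
have [->|nx] /= := eqVneq x 0; first by rewrite sub0r oppr_eq0 valuationN.
have [->|ny] /= := eqVneq y 0; first by rewrite subr0 (negPf nx).
have [//|nxy] /= := eqVneq (x - y) 0 => bx bY.
have nNy : - y != 0 by rewrite oppr_eq0.
by apply: le_trans (valuationD nu nx nNy nxy); rewrite valuationN le_min bx.
Qed.

Lemma val_gtB b : {in val_gt b &, forall x y, x - y \in val_gt b}.
Proof.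
move=> x y; rewrite !inE.
have [->|nx] /= := eqVneq x 0; first by rewrite sub0r oppr_eq0 valuationN.
have [->|ny] /= := eqVneq y 0; first by rewrite subr0 (negPf nx).
have [//|nxy] /= := eqVneq (x - y) 0 => bx bY.
have nNy : - y != 0 by rewrite oppr_eq0.
by apply: lt_le_trans (valuationD nu nx nNy nxy); rewrite valuationN lt_min bx.
Qed.

Lemma val_geM b c x y : x \in val_ge b -> y \in val_ge c -> x * y \in val_ge (b + c).
Proof.
rewrite !inE mulf_eq0; have [|nx] //= := eqVneq x 0.
by have [|ny] //= := eqVneq y 0 => bx cy; rewrite valuationM // ord_leD.
Qed.

Lemma val_gtM b c x y : x \in val_ge b -> y \in val_gt c -> x * y \in val_gt (b + c).
Proof.
rewrite !inE mulf_eq0; have [|nx] //= := eqVneq x 0.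
by have [|ny] //= := eqVneq y 0 => bx cy; rewrite valuationM // ord_ltD.
Qed.

Lemma val_ge0 b : 0 \in val_ge b. Proof. by rewrite inE eqxx. Qed.
Lemma val_gt0 b : 0 \in val_gt b. Proof. by rewrite inE eqxx. Qed.

Definition in_valring : {pred L} := val_ge 0.

Lemma in_valring_subring : subring_closed in_valring.
Proof.
split; first by rewrite inE valuation1 lexx orbT.
  exact: val_geB.
by move=> x y xP yP; rewrite /in_valring -[X in val_ge X]addr0; apply: val_geM.
Qed.
HB.instance Definition _ := GRing.isSubringClosed.Build L in_valring in_valring_subring.

Record valring := ValRing { valring_val :> L; _ : valring_val \in in_valring }.
HB.instance Definition _ := [isSub for valring_val].
HB.instance Definition _ := [Choice of valring by <:].
HB.instance Definition _ := [SubChoice_isSubComNzRing of valring by <:].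

Definition in_maxideal : {pred valring} := [pred y | val y \in val_gt 0].

Lemma in_maxideal_ideal : idealr_closed in_maxideal.
Proof.
split; first by rewrite inE raddf0 val_gt0.
  by rewrite !inE rmorph1 oner_eq0 valuation1 ltxx.
move=> a x y xP yP; rewrite inE rmorphD rmorphM /= -[_ + _]/(_ + val y) -[val y]opprK.
have Ny : - val y \in val_gt 0 by rewrite -sub0r val_gtB ?val_gt0.
by apply: val_gtB => //; rewrite -[X in val_gt X]addr0; apply: val_gtM => //; apply: valP.
Qed.
HB.instance Definition _ := isIdealr.Build valring in_maxideal in_maxideal_ideal.

(* Only the ring structure is needed, to speak of its characteristic. *)
Definition residue_field : comNzRingType := {ideal_quot in_maxideal}.

End Valuations.

(* Finitely supported functions V -> L, with convolution as product. The ring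
   structure of monalg requires a monoid without inverses, which V is not. *)
Definition group_algebra (L : comNzRingType) (V : zmodType) := @monalg.malg V L.

Section GroupAlgebra.
Variables (L : comNzRingType) (V : zmodType).
Local Notation A := (group_algebra L V).
Local Notation U := (@monalg.mkmalgU V L).
Local Notation supp := (@monalg.msupp V L).
Local Notation coef := (fun g k => @monalg.mcoeff V L k g).
Implicit Types g : A.

HB.instance Definition _ := GRing.Zmodule.copy (group_algebra L V) (@monalg.malg V L).

Definition ga_mul g1 g2 : A :=
  \sum_(k1 <- supp g1) \sum_(k2 <- supp g2) U (k1 + k2) (coef g1 k1 * coef g2 k2).
Definition ga_one : A := U 0 1.

Lemma ga_mulw (d1 d2 : {fset V}) g1 g2 :
  (supp g1 `<=` d1)%fset -> (supp g2 `<=` d2)%fset ->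
  ga_mul g1 g2 =
  \sum_(k1 <- d1) \sum_(k2 <- d2) U (k1 + k2) (coef g1 k1 * coef g2 k2).
Proof.
move=> le_d1 le_d2; rewrite /ga_mul (big_fset_incl _ le_d1) /=.
  apply/eq_bigr=> k1 _; apply/big_fset_incl => // k _ /monalg.mcoeff_outdom ->.
  by rewrite mulr0 monalg.monalgU0.
move=> k _ /monalg.mcoeff_outdom g1k.
by rewrite big1 => // k' _; rewrite g1k mul0r monalg.monalgU0.
Qed.

Lemma ga_mulC : commutative ga_mul.
Proof.
move=> g1 g2; rewrite /ga_mul exchange_big /=.
by apply: eq_bigr => k1 _; apply: eq_bigr => k2 _; rewrite addrC mulrC.
Qed.

Lemma ga_mulDl : left_distributive ga_mul +%R.
Proof.
move=> g1 g2 g.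
rewrite [in RHS](ga_mulw (fsubsetUl _ (supp g2)) (fsubset_refl _)).
rewrite [in RHS](ga_mulw (fsubsetUr (supp g1) _) (fsubset_refl _)).
rewrite (ga_mulw (monalg.msuppD_le _ _) (fsubset_refl _)).
rewrite -big_split /=; apply/eq_bigr=> k1 _.
rewrite -big_split /=; apply/eq_bigr=> k2 _.
by rewrite monalg.mcoeffD mulrDl monalg.monalgUD.
Qed.

Lemma ga_mul0 : left_zero 0 ga_mul.
Proof. by move=> g; rewrite /ga_mul monalg.msupp0 big_seq_fset0. Qed.

Lemma ga_mulUU c1 c2 k1 k2 : ga_mul (U k1 c1) (U k2 c2) = U (k1 + k2) (c1 * c2).
Proof.
by rewrite (ga_mulw monalg.msuppU_le monalg.msuppU_le) !big_seq_fset1 !monalg.mcoeffUU.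
Qed.

Lemma ga_mul_suml (I : Type) (r : seq I) (F : I -> A) g :
  ga_mul (\sum_(i <- r) F i) g = \sum_(i <- r) ga_mul (F i) g.
Proof. exact: (big_morph (ga_mul^~ g) (fun _ _ => ga_mulDl _ _ _) (ga_mul0 g)). Qed.

Lemma ga_ind (P : A -> Prop) : P 0 -> (forall g1 g2, P g1 -> P g2 -> P (g1 + g2)) ->
  (forall k c, P (U k c)) -> forall g, P g.
Proof.
by move=> P0 PD PU g; rewrite [g]monalg.monalgE; elim/big_ind: _.
Qed.

Lemma ga_mulA : associative ga_mul.
Proof.
have mulDr g g1 g2 : ga_mul g (g1 + g2) = ga_mul g g1 + ga_mul g g2.
  by rewrite ga_mulC ga_mulDl ![ga_mul g _]ga_mulC.
have mul0r' g : ga_mul g 0 = 0 by rewrite ga_mulC ga_mul0.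
elim/ga_ind => [|g1 g1' h h'|k1 c1] g2 g3; first by rewrite !ga_mul0.
  by rewrite !ga_mulDl h h'.
elim/ga_ind: g2 => [|g1 g1' h h'|k2 c2]; first by rewrite !(ga_mul0, mul0r').
  by rewrite !(ga_mulDl, mulDr) h h'.
elim/ga_ind: g3 => [|g1 g1' h h'|k3 c3]; first by rewrite !mul0r'.
  by rewrite !mulDr h h'.
by rewrite !ga_mulUU addrA mulrA.
Qed.

Lemma ga_mul1 : left_id ga_one ga_mul.
Proof.
elim/ga_ind => [|g1 g1' h h'|k c]; first by rewrite ga_mulC ga_mul0.
  by rewrite ga_mulC ga_mulDl ![ga_mul _ ga_one]ga_mulC h h'.
by rewrite ga_mulUU add0r mul1r.
Qed.

Lemma ga_one_neq0 : ga_one != 0.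
Proof. by rewrite monalg.monalgU_eq0 oner_eq0. Qed.

HB.instance Definition _ := GRing.Zmodule_isComNzRing.Build A
  ga_mulA ga_mulC ga_mul1 ga_mulDl ga_one_neq0.
End GroupAlgebra.

Section GradedAlgebra.
Variables (L : fieldType) (V : orderedQSpace) (nu : valuation L V).
Local Notation A := (group_algebra L V).

Definition ga_single (b : V) (y : L) : A := monalg.mkmalgU b y.

Definition in_rees : {pred A} :=
  [pred f : A | all (fun b => monalg.mcoeff b f \in val_ge nu b) (monalg.msupp f)].

Lemma in_reesP (f : A) :
  reflect (forall b, monalg.mcoeff b f \in val_ge nu b) (f \in in_rees).
Proof.
apply: (iffP allP) => [H b|H b _]; last exact: H.
by case: (monalg.msuppP f b) => [/H //|_]; exact: val_ge0.
Qed.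

Lemma ga_single_rees b y : y \in val_ge nu b -> ga_single b y \in in_rees.
Proof.
move=> yb; apply/in_reesP => c; rewrite monalg.mcoeffU.
by case: eqP => [<-|_]; [rewrite mulr1n | exact: val_ge0].
Qed.

Lemma in_rees_subring : subring_closed in_rees.
Proof.
have reesB : {in in_rees &, forall f g, f - g \in in_rees}.
  move=> f g /in_reesP fP /in_reesP gP; apply/in_reesP => b.
  by rewrite monalg.mcoeffB val_geB.
have rees0 : 0 \in in_rees by apply/in_reesP => b; rewrite monalg.mcoeff0 val_ge0.
have reesD : {in in_rees &, forall f g, f + g \in in_rees}.
  by move=> f g fP gP; rewrite -[g]opprK reesB // -sub0r reesB.
split=> //; first by apply: ga_single_rees; rewrite inE valuation1 lexx orbT.
move=> f g /in_reesP fP /in_reesP gP; rewrite -[f * g]/(ga_mul f g).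
do 2![apply: (big_ind (fun h => h \in in_rees)) => // ? _].
by apply/ga_single_rees/val_geM.
Qed.
HB.instance Definition _ := GRing.isSubringClosed.Build A in_rees in_rees_subring.

(* The direct sum of the P_b, as a subring of the group algebra of V over L. *)
Record rees := Rees { rees_val :> A; _ : rees_val \in in_rees }.
HB.instance Definition _ := [isSub for rees_val].
HB.instance Definition _ := [Choice of rees by <:].
HB.instance Definition _ := [SubChoice_isSubComNzRing of rees by <:].

Definition in_rees_gt : {pred rees} :=
  [pred f : rees | all (fun b => monalg.mcoeff b (val f) \in val_gt nu b)
                       (monalg.msupp (val f))].

Lemma in_rees_gtP (f : rees) :
  reflect (forall b, monalg.mcoeff b (val f) \in val_gt nu b) (f \in in_rees_gt).
Proof.
apply: (iffP allP) => [H b|H b _]; last exact: H.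
by case: (monalg.msuppP (val f) b) => [/H //|_]; exact: val_gt0.
Qed.

Lemma in_rees_gt_ideal : idealr_closed in_rees_gt.
Proof.
have gtD b : {in val_gt nu b &, forall x y, x + y \in val_gt nu b}.
  by move=> x y xP yP; rewrite -[y]opprK val_gtB // -sub0r val_gtB ?val_gt0.
split.
- by apply/in_rees_gtP => b; rewrite rmorph0 monalg.mcoeff0 val_gt0.
- apply/in_rees_gtP => /(_ 0); rewrite rmorph1 monalg.mcoeffUU.
  by rewrite inE oner_eq0 valuation1 ltxx.
move=> a f g /in_rees_gtP fP /in_rees_gtP gP; apply/in_rees_gtP => b.
have /in_reesP aP := valP a.
rewrite rmorphD rmorphM monalg.mcoeffD; apply: (gtD b) => //.
rewrite -[val a * val f]/(ga_mul _ _).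
do 2![rewrite (raddf_sum (monalg.mcoeff b));
  apply: (big_ind (fun y => y \in val_gt nu b)) => [||? _];
  [exact: val_gt0 | exact: (gtD b) |]].
rewrite /= monalg.mcoeffU; case: eqP => [<-|_]; last exact: val_gt0.
by rewrite mulr1n val_gtM.
Qed.
HB.instance Definition _ := isIdealr.Build rees in_rees_gt in_rees_gt_ideal.

(* (direct sum of the P_b) / (direct sum of the P_{b+}); the summands with b
   outside the value group vanish. *)
Definition graded_alg : comNzRingType := {ideal_quot in_rees_gt}.

(* The class of y in degree b; only meaningful for y in P_b. *)
Definition gr_class (b : V) (y : L) : graded_alg :=
  \pi_({ideal_quot in_rees_gt})%qT (insubd (0 : rees) (ga_single b y)).

Definition initial (y : L) : graded_alg := gr_class (nu y) y.

Definition homogeneous (u : graded_alg) : Prop :=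
  exists b y, y \in val_ge nu b /\ u = gr_class b y.

(* For a graded subring S of the graded algebra of a field, the nonzero
   homogeneous elements of S are invertible in the latter, so S^* is realised
   inside it: [u] is g / h iff u * h = g. *)
Definition star (S : set graded_alg) : set graded_alg :=
  [set u | exists g h, [/\ S g, S h, homogeneous h, h != 0 & u * h = g]].

End GradedAlgebra.

Definition generated_subring (G : comNzRingType) (S : set G) : set G :=
  [set u | forall P : set G, S `<=` P -> P 1 ->
    (forall a b, P a -> P b -> P (a - b)) ->
    (forall a b, P a -> P b -> P (a * b)) -> P u].

Definition minimal_relation (G : comNzRingType) (F : set G) (theta : G)
    (P : {poly G}) : Prop :=
  [/\ P \is monic, (forall j, F P`_j), root P theta &
      forall R : {poly G}, R != 0 -> (forall j, F R`_j) -> root R theta ->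
        (size P <= size R)%N].

Section Indices.
Variables (disp : Order.disp_t) (Lam : bOrderType disp).
Implicit Types (i j k l : Lam) (D : set Lam).

Definition is_succ i j : Prop := (i < j)%O /\ forall k, (i < k)%O -> (j <= k)%O.

(* [lsucc i] is i + 1, and i when i is the maximum *)
Definition lsucc i : Lam := xget i [set j | is_succ i j].
Definition shift i (t : nat) : Lam := iter t lsucc i.

(* k = i + omega; this cannot hold when [shift i] stagnates *)
Definition is_plus_omega i k : Prop :=
  (forall t, (shift i t < k)%O) /\
  forall m, (forall t, (shift i t < m)%O) -> (k <= m)%O.

Variable alpha : Lam -> nat.

(* D is an initial segment, in which i + omega and i+ are computed *)
Definition inessential D i : Prop :=
  (exists2 k, D k & is_plus_omega i k) /\ forall t, alpha (shift i t) = 1%N.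

(* j = i+ *)
Definition is_plus D i j : Prop :=
  D j /\ ((inessential D i /\ is_plus_omega i j) \/
          (~ inessential D i /\ is_succ i j)).

Definition upto l : set Lam := [set q | (q <= l)%O].

Definition same_plus D i j : Prop := exists k, is_plus D i k /\ is_plus D j k.

Definition exponent := {fsfun Lam -> nat with 0%N}.

Definition standard l (g : exponent) : Prop :=
  [/\ (forall i, g i != 0%N -> (i <= l)%O),
      (forall i j, (i < l)%O -> is_plus (upto l) i j -> (g i < alpha j)%N) &
      (forall i, inessential (upto l) i -> forall j k,
         same_plus (upto l) j i -> same_plus (upto l) k i ->
         g j != 0%N -> g k != 0%N -> j = k)].

End Indices.

Definition pdeg (K : fieldType) (f : {poly K}) : nat := (size f).-1.

Definition is_min (I : Type) (V : orderedQSpace) (P : set I) (F : I -> V) (m : V) :=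
  (exists2 i, P i & F i = m) /\ forall i, P i -> m <= F i.

(* Coefficient of Q^j in the Q-expansion of f, for Q monic of positive degree. *)
Definition qcoef (K : fieldType) (Q f : {poly K}) (j : nat) : {poly K} :=
  (f %/ Q ^+ j) %% Q.

Lemma qcoef_expansion (K : fieldType) (Q f : {poly K}) : (1 < size Q)%N ->
  f = \sum_(j < size f) qcoef Q f j * Q ^+ j /\
  forall j, (size (qcoef Q f j) < size Q)%N.
Proof.
move=> sQ; have nQ : Q != 0 by rewrite -size_poly_gt0 ltnW.
split; last by move=> j; rewrite ltn_modp.
have H n : f = f %/ Q ^+ n * Q ^+ n + \sum_(j < n) qcoef Q f j * Q ^+ j.
  elim: n => [|n IH]; first by rewrite big_ord0 addr0 expr0 mulr1 divp1.
  rewrite big_ord_recr /= addrCA addrC {1}IH; congr (_ + _).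
  by rewrite {1}(divp_eq (f %/ Q ^+ n) Q) mulrDl -mulrA -exprS divp_divl -exprSr.
rewrite {1}(H (size f)) divp_small ?mul0r ?add0r //.
rewrite -[X in (_ < X)%N]prednK ?size_poly_gt0 ?expf_neq0 // size_exp ltnS.
by rewrite leq_pmull // -ltnS prednK // ltnW.
Qed.

Section KeyPolynomials.
Variables (K : fieldType) (V : orderedQSpace).
Variable nu : valuation {fraction {poly K}} V.
Local Notation iota := (@tofrac {poly K}).

Definition nup (f : {poly K}) : V := nu (iota f).

Lemma valK_M (x y : K) : x != 0 -> y != 0 ->
  nup (x * y)%:P = nup x%:P + nup y%:P.
Proof. by move=> nx ny; rewrite /nup rmorphM /= rmorphM valuationM // tofrac_eq0 polyC_eq0. Qed.

Lemma valK_D (x y : K) : x != 0 -> y != 0 -> x + y != 0 ->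
  Order.min (nup x%:P) (nup y%:P) <= nup (x + y)%:P.
Proof.
move=> nx ny nxy; rewrite /nup polyCD rmorphD valuationD -?rmorphD ?tofrac_eq0 //=.
all: by rewrite -?polyCD ?tofrac_eq0 polyC_eq0.
Qed.

Definition nuK : valuation K V := Valuation valK_M valK_D.

(* V = Gamma (x) Q, for Gamma the value group of nu *)
Definition spanned_by_values : Prop := rational_hull nu = setT.

Definition Gam0Q : set V := rational_hull nuK.

Definition bounded_in (D B : set V) : Prop := exists2 v, D v & forall b, B b -> b <= v.

Section Truncation.
Variables (Q f : {poly K}).

(* nu_i(f) = m, for Q = Q_i *)
Definition trunc_val (m : V) : Prop :=
  is_min [set j | qcoef Q f j != 0] (fun j => nup (qcoef Q f j) + nup Q *+ j) m.

Definition trunc_set : set nat :=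
  [set j | qcoef Q f j != 0 /\ trunc_val (nup (qcoef Q f j) + nup Q *+ j)].

(* delta_i(f) = d *)
Definition trunc_delta (d : nat) : Prop :=
  trunc_set d /\ forall j, trunc_set j -> (j <= d)%N.

End Truncation.

Variables (disp : Order.disp_t) (Lam : bOrderType disp).
Variables (alpha : Lam -> nat) (Q : Lam -> {poly K}).
Implicit Types (i l : Lam).

Definition mono (g : exponent Lam) : {poly K} := \prod_(i <- finsupp g) Q i ^+ g i.

(* The finite family of the coefficients c_gamma in \sum_gamma c_gamma M_gamma;
   terms with coefficient 0 do not occur. *)
Definition combination := {fsfun exponent Lam -> K with 0}.
Definition comb_poly (c : combination) : {poly K} :=
  \sum_(g <- finsupp c) (c g)%:P * mono g.

(* c is a Q_l-free l-standard expansion *)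
Definition free_standard l (c : combination) : Prop :=
  (forall g, g \in finsupp c -> standard alpha l g /\ g l = 0%N) /\
  (finsupp c != fset0 -> comb_poly c != 0 /\
     is_min [set g | g \in finsupp c] (fun g => nup ((c g)%:P * mono g))
            (nup (comb_poly c))).

Definition standard_expansion l (f : {poly K}) (n : nat) (c : nat -> combination) : Prop :=
  (forall j, (j <= n)%N -> free_standard l (c j)) /\
  f = \sum_(j < n.+1) comb_poly (c j) * Q l ^+ j.

Definition expansion_min l (n : nat) (c : nat -> combination) (m : V) : Prop :=
  is_min [set j | (j <= n)%N /\ comb_poly (c j) != 0]
         (fun j => nup (comb_poly (c j) * Q l ^+ j)) m.

(* Existence is part of the property, so that no polynomial enters vacuously
   the competition for the smallest degree in [key_limit]. *)
Definition value_jumps l (f : {poly K}) : Prop :=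
  (exists n c, standard_expansion l f n c) /\
  forall n c, standard_expansion l f n c ->
    exists2 m, expansion_min l n c m & m < nup f.

(* G_{nu_K}[in_nu Q_q, q < l], where G_{nu_K} is identified with its image in
   G_nu, generated by the in_nu c with c in K *)
Definition graded_sub l : set (graded_alg nu) :=
  generated_subring
    ([set u | exists c : K, u = initial nu (iota c%:P)] `|`
     [set u | exists2 q, (q < l)%O & u = initial nu (iota (Q q))]).

Definition initial_relation (a : nat) (c : nat -> combination) : {poly graded_alg nu} :=
  'X^a + \sum_(j < a)
     (\sum_(g <- finsupp (c j))
        initial nu (iota (c j g)%:P) * initial nu (iota (mono g)))%:P * 'X^j.

Definition prekey_polynomials : Prop :=
  [/\ Q \bot%O = 'X, (forall i, Q i \is monic),
      (forall i, (0 < alpha i)%N) /\ alpha \bot%O = 1%N &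
      forall i i0, (exists k, (i < k)%O) -> (i0 < i)%O ->
        is_plus alpha setT i0 i -> pdeg (Q i) = (alpha i * pdeg (Q i0))%N].

Definition key_values : Prop :=
  forall i, (exists k, (i < k)%O) -> Gam0Q (nup (Q i)).

Definition key_successor : Prop :=
  forall p i, is_succ p i ->
  exists c : nat -> combination,
    [/\ forall j, (j < alpha i)%N -> free_standard p (c j),
        Q i = Q p ^+ alpha i + \sum_(j < alpha i) comb_poly (c j) * Q p ^+ j,
        (forall j g, (j < alpha i)%N -> g \in finsupp (c j) ->
           nup ((c j g)%:P * mono g * Q p ^+ j) = nup (Q p ^+ alpha i)) &
        minimal_relation (star (graded_sub p)) (initial nu (iota (Q p)))
          (initial_relation (alpha i) c)].

Definition key_limit : Prop :=
  forall i, i != \bot%O -> (forall p, ~ is_succ p i) ->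
  [/\ exists i0, is_plus alpha setT i0 i,
      forall i0, is_plus alpha setT i0 i ->
        (exists c, standard_expansion i0 (Q i) (alpha i) c) /\
        value_jumps i0 (Q i),
      forall f : {poly K},
        (forall i0, is_plus alpha setT i0 i -> value_jumps i0 f) ->
        (pdeg (Q i) <= pdeg f)%N &
      bounded_in Gam0Q [set nup (Q j) | j in [set j | (j < i)%O]] ->
      forall i0 c, is_plus alpha setT i0 i ->
        standard_expansion i0 (Q i) (alpha i) c ->
        [/\ comb_poly (c (alpha i)) = 1,
            expansion_min i0 (alpha i) c (nup (Q i0) *+ alpha i),
            comb_poly (c 0%N) != 0 &
            nup (comb_poly (c 0%N)) = nup (Q i0) *+ alpha i]].

Definition key_cofinal : Prop :=
  forall n, infinite_set [set i | pdeg (Q i) = n] ->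
  forall f : {poly K}, f \is monic -> pdeg f = n ->
  exists2 i, pdeg (Q i) = n & nup f <= nup (Q i).

Definition key_polynomials : Prop :=
  [/\ countable [set: Lam], wochoice.well_order (<=%O : rel Lam) &
      [/\ prekey_polynomials, key_values, key_successor, key_limit & key_cofinal]].

Definition complete : Prop :=
  forall f : {poly K}, f != 0 -> exists i, trunc_val (Q i) f (nup f).

End KeyPolynomials.

(* Main.v *)
Require Import Defs.
From mathcomp Require Import all_boot all_order all_algebra.
From mathcomp Require Import finmap.
From mathcomp Require Import boolp classical_sets.
From mathcomp Require wochoice.
From mathcomp Require Import -(notations) monalg.

Set Implicit Arguments.
Unset Strict Implicit.
Unset Printing Implicit Defensive.
Import Order.TTheory GRing.Theory.
Local Open Scope classical_set_scope.
Local Open Scope ring_scope.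

(** Monic polynomials of degree less than deg Q_i have values bounded above in the rational
    hull of the value group of K. Hence on polynomials of degree less than n = deg Q_l the
    valuation agrees, up to a bounded error, with the Gauss valuation, and dividing by the
    monic polynomials Q_(l+t) keeps coefficients bounded: the coefficients of the
    Q_(l+t)-expansion of a fixed f are bounded below uniformly in t. If nu f were rational
    and beta_(l+t) large, the constant term alone would then carry the value nu f. A limit
    key polynomial h jumps above every truncation, so nu h is irrational.

    The upper bound is proved by induction on i: by minimality of the algebraic relation
    (successors) or of the degree (limits), some truncation preceding Q_i computes the value
    of every polynomial of degree less than deg Q_i, and an unbounded omega-sequence below a
    non-maximal Q_i is excluded by the argument above.

    When deg Q_t = 1, Q_t = x - a_t, the b-th coefficient of the expansion of h is the b-th
    Hasse derivative at a_t, whose value is that of the derivative itself for large t. So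
    delta is the least b >= 1 with nonzero b-th Hasse derivative, which is the largest power
    of the characteristic exponent dividing all exponents of h. *)

(** * Ordered spaces and valuations *)

Section OrderedSpace.
Variable V : orderedQSpace.
Implicit Types x y z b : V.

Lemma ord_leD2rE z x y : (x + z <= y + z) = (x <= y).
Proof.
apply/idP/idP => [/(ord_leD2r (- z))|/ord_leD2r]; last exact.
by rewrite !addrK.
Qed.

Lemma ord_leD2lE z x y : (z + x <= z + y) = (x <= y).
Proof. by rewrite ![z + _]addrC ord_leD2rE. Qed.

Lemma ord_ltD2rE z x y : (x + z < y + z) = (x < y).
Proof. by rewrite !ltNge ord_leD2rE. Qed.

Lemma ord_lebl x y z : (x <= y + z) = (x - z <= y).
Proof. by rewrite -(ord_leD2rE (- z)) addrK. Qed.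

Lemma ord_ltbl x y z : (x < y + z) = (x - z < y).
Proof. by rewrite -(ord_ltD2rE (- z)) addrK. Qed.

Lemma ord_oppr_le0 x : (- x <= 0) = (0 <= x).
Proof. by rewrite -(ord_leD2rE x) addNr add0r. Qed.

Lemma ord_leNl x y : (- x <= y) = (- y <= x).
Proof. by rewrite -(ord_leD2rE (x - y)) addKr addrCA subrr addr0. Qed.

Lemma ord_subr_le b x : 0 <= b -> x - b <= x.
Proof. by move=> b0; rewrite -[X in _ <= X]addr0 ord_leD2lE ord_oppr_le0. Qed.

Lemma ord_mulrn_ge0 b n : 0 <= b -> 0 <= b *+ n.
Proof.
by move=> b0; elim: n => [|n IH]; rewrite ?mulr0n // mulrS -[X in X <= _]addr0 ord_leD.
Qed.

Lemma ord_mulrn_leS b n : 0 <= b -> b <= b *+ n.+1.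
Proof. by move=> b0; rewrite mulrS -[X in X <= _]addr0 ord_leD2lE ord_mulrn_ge0. Qed.

Lemma ord_mulrn_le b m n : 0 <= b -> (m <= n)%N -> b *+ m <= b *+ n.
Proof.
move=> b0 /subnK <-; rewrite mulrnDr -[X in X <= _]add0r ord_leD2rE.
exact: ord_mulrn_ge0.
Qed.

Lemma ord_mulrn_le2 x y n : x <= y -> x *+ n <= y *+ n.
Proof. by move=> xy; elim: n => [|n IH]; rewrite ?mulr0n // !mulrS ord_leD. Qed.

End OrderedSpace.

(** * The rational hull of a value group as a rational vector space *)

Section RationalHull.
Variables (L : fieldType) (V : orderedQSpace) (nu : valuation L V).

Lemma valuationV x : x != 0 -> nu x^-1 = - nu x.
Proof.
move=> nx; apply/eqP; rewrite -subr_eq0 opprK -valuationM ?invr_eq0 //.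
by rewrite mulVf // valuation1.
Qed.

Lemma valuationX x n : x != 0 -> nu (x ^+ n) = nu x *+ n.
Proof.
move=> nx; elim: n => [|n IH]; first by rewrite expr0 valuation1 mulr0n.
by rewrite exprS mulrS valuationM ?expf_neq0 // IH.
Qed.

Lemma value_groupD g h : value_group nu g -> value_group nu h -> value_group nu (g + h).
Proof.
move=> [x nx <-] [y ny <-]; exists (x * y); last by rewrite valuationM.
exact: mulf_neq0.
Qed.

Lemma value_groupZ g (n : int) : value_group nu g -> value_group nu (g *~ n).
Proof.
case=> x nx <-; case: n => n.
  by exists (x ^+ n); [exact: expf_neq0 | rewrite valuationX // -pmulrn].
exists (x ^+ n.+1)^-1; first by rewrite /mkset invr_eq0 expf_neq0.
by rewrite valuationV ?expf_neq0 // valuationX // NegzE mulrNz -pmulrn.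
Qed.

Lemma rational_hull_value x : x != 0 -> rational_hull nu (nu x).
Proof. by move=> nx; exists 1, (nu x); split; [exists x | rewrite scale1r]. Qed.

Lemma rational_hull0 : rational_hull nu 0.
Proof. by rewrite -(valuation1 nu); apply: rational_hull_value; exact: oner_neq0. Qed.

Lemma rational_hullZ (q : rat) v : rational_hull nu v -> rational_hull nu (q *: v).
Proof. by move=> [r [g [gG ->]]]; exists (q * r), g; rewrite scalerA. Qed.

Lemma rational_hullD u v :
  rational_hull nu u -> rational_hull nu v -> rational_hull nu (u + v).
Proof.
move=> [q [g [gG ->]]] [r [h [hG ->]]].
(* The hull consists of rational multiples of a single value, so the two fractions are brought to a
   common denominator. *)
exists ((denq q * denq r)%:~R^-1), (g *~ (numq q * denq r) + h *~ (numq r * denq q)).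
split; first by apply: value_groupD; apply: value_groupZ.
have nq : (denq q)%:~R != 0 :> rat by rewrite intr_eq0 denq_neq0.
have nr : (denq r)%:~R != 0 :> rat by rewrite intr_eq0 denq_neq0.
rewrite scalerDr -!scaler_int !scalerA !intrM invfM; congr (_ *: _ + _ *: _).
  by rewrite -{1}[q]divq_num_den mulrACA [_ * (_)%:~R]mulrC mulVf // mulr1.
rewrite [(denq q)%:~R^-1 * _]mulrC -{1}[r]divq_num_den mulrACA.
by rewrite [_ * (numq r)%:~R]mulrC mulVf // mulr1.
Qed.

Lemma rational_hullN v : rational_hull nu v -> rational_hull nu (- v).
Proof. by rewrite -scaleN1r; apply: rational_hullZ. Qed.

Lemma rational_hullMn v n : rational_hull nu v -> rational_hull nu (v *+ n).
Proof. by rewrite -scaler_nat; apply: rational_hullZ. Qed.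

Lemma rational_hull_max u v :
  rational_hull nu u -> rational_hull nu v -> rational_hull nu (Order.max u v).
Proof. by move=> uP vP; rewrite maxElt; case: ifP. Qed.

End RationalHull.

(** * Values of polynomials, with the zero polynomial above every bound *)

Section Values.
Variables (K : fieldType) (V : orderedQSpace).
Variable nu : valuation {fraction {poly K}} V.
Implicit Types (f g : {poly K}) (b : V).
Local Notation nup := (nup nu).

Lemma nupM f g : f != 0 -> g != 0 -> nup (f * g) = nup f + nup g.
Proof. by move=> nf ng; rewrite /Defs.nup rmorphM valuationM ?tofrac_eq0. Qed.

Lemma nup1 : nup 1 = 0.
Proof. by rewrite /Defs.nup rmorph1 valuation1. Qed.

Lemma nupN f : nup (- f) = nup f.
Proof. by rewrite /Defs.nup rmorphN valuationN. Qed.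

Lemma nupX f n : f != 0 -> nup (f ^+ n) = nup f *+ n.
Proof. by move=> nf; rewrite /Defs.nup rmorphXn valuationX ?tofrac_eq0. Qed.

(* Here [nu 0 = +oo]. *)
Definition pge b f := (f == 0) || (b <= nup f).
Definition pgt b f := (f == 0) || (b < nup f).

Lemma pgeE b f : pge b f = (tofrac f \in val_ge nu b).
Proof. by rewrite inE tofrac_eq0. Qed.

Lemma pgtE b f : pgt b f = (tofrac f \in val_gt nu b).
Proof. by rewrite inE tofrac_eq0. Qed.

Lemma pge0 b : pge b 0. Proof. by rewrite /pge eqxx. Qed.
Lemma pgt0 b : pgt b 0. Proof. by rewrite /pgt eqxx. Qed.

Lemma pge_refl f : pge (nup f) f. Proof. by rewrite /pge lexx orbT. Qed.

Lemma pge_nup b f : b <= nup f -> pge b f. Proof. by rewrite /pge => ->; rewrite orbT. Qed.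
Lemma pgt_nup b f : b < nup f -> pgt b f. Proof. by rewrite /pgt => ->; rewrite orbT. Qed.

Lemma pgt_irr f : f != 0 -> pgt (nup f) f = false.
Proof. by move=> /negPf nf; rewrite /pgt nf ltxx. Qed.

Lemma pgtW b f : pgt b f -> pge b f.
Proof. by rewrite /pge; case/orP => [->//|/ltW ->]; rewrite orbT. Qed.

Lemma pge_trans b c f : b <= c -> pge c f -> pge b f.
Proof. by move=> bc /orP[/eqP->|/(le_trans bc) h]; rewrite ?pge0 // /pge h orbT. Qed.

Lemma pge_gt b c f : b < c -> pge c f -> pgt b f.
Proof. by move=> bc /orP[/eqP->|/(lt_le_trans bc) h]; rewrite ?pgt0 // /pgt h orbT. Qed.

Lemma pgeN b f : pge b (- f) = pge b f.
Proof. by rewrite /pge oppr_eq0 nupN. Qed.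

Lemma pgtN b f : pgt b (- f) = pgt b f.
Proof. by rewrite /pgt oppr_eq0 nupN. Qed.

Lemma pgeB b f g : pge b f -> pge b g -> pge b (f - g).
Proof. by rewrite !pgeE rmorphB; apply: val_geB. Qed.

Lemma pgeD b f g : pge b f -> pge b g -> pge b (f + g).
Proof. by move=> bf bg; rewrite -[g]opprK pgeB ?pgeN. Qed.

Lemma pgtB b f g : pgt b f -> pgt b g -> pgt b (f - g).
Proof. by rewrite !pgtE rmorphB; apply: val_gtB. Qed.

Lemma pgtD b f g : pgt b f -> pgt b g -> pgt b (f + g).
Proof. by move=> bf bg; rewrite -[g]opprK pgtB ?pgtN. Qed.

Lemma pge_sum (I : Type) (r : seq I) (P : pred I) (F : I -> {poly K}) b :
  (forall i, P i -> pge b (F i)) -> pge b (\sum_(i <- r | P i) F i).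
Proof.
by move=> H; apply: (big_ind (fun f => is_true (pge b f))) => //; [exact: pge0 | exact: pgeD].
Qed.

Lemma pgt_sum (I : Type) (r : seq I) (P : pred I) (F : I -> {poly K}) b :
  (forall i, P i -> pgt b (F i)) -> pgt b (\sum_(i <- r | P i) F i).
Proof.
by move=> H; apply: (big_ind (fun f => is_true (pgt b f))) => //; [exact: pgt0 | exact: pgtD].
Qed.

Lemma pgeM b c f g : pge b f -> pge c g -> pge (b + c) (f * g).
Proof. by rewrite !pgeE rmorphM; apply: val_geM. Qed.

Lemma nup_ge b f : f != 0 -> pge b f -> b <= nup f.
Proof. by move=> /negPf nf; rewrite /pge nf. Qed.

Lemma nup_gt b f : f != 0 -> pgt b f -> b < nup f.
Proof. by move=> /negPf nf; rewrite /pgt nf. Qed.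

(** If f + g had a value larger than nu f, then so would f = (f + g) - g. *)
Lemma nup_addr_pgt f g : f != 0 -> pgt (nup f) g -> f + g != 0 /\ nup (f + g) = nup f.
Proof.
move=> nf gt; have n0 : f + g != 0.
  apply: contraTneq gt => /eqP; rewrite addrC addr_eq0 => /eqP ->.
  by rewrite pgtN /pgt (negPf nf) ltxx.
split=> //; apply/eqP; rewrite eq_le; apply/andP; split; last first.
  by apply: nup_ge => //; rewrite pgeD ?pge_refl ?pgtW.
rewrite leNgt; apply/negP => lt.
have : pgt (nup f) (f + g - g) by rewrite pgtB // /pgt lt orbT.
by rewrite addrK /pgt (negPf nf) ltxx.
Qed.

Lemma Gam0Q_const (c : K) : c != 0 -> Gam0Q nu (nup c%:P).
Proof. by move=> nc; exact: (@rational_hull_value _ _ (nuK nu) c nc). Qed.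

End Values.

(** * Q-expansions *)

Section Expansions.
Variable K : fieldType.
Implicit Types (P f g : {poly K}).

Lemma size_polyXn_pdeg P n : P != 0 -> size (P ^+ n) = (pdeg P * n).+1.
Proof.
move=> nP; have := size_exp P n; rewrite -/(pdeg P) => <-.
by rewrite prednK // size_poly_gt0 expf_neq0.
Qed.

Lemma size_pdeg P : P != 0 -> size P = (pdeg P).+1.
Proof. by move=> nP; rewrite /pdeg prednK // size_poly_gt0. Qed.

Lemma size_sum_expansion P (e : nat -> {poly K}) n : P != 0 ->
  (forall j, (j < n)%N -> (size (e j) < size P)%N) ->
  (size (\sum_(j < n) e j * P ^+ j)%R < size (P ^+ n)%R)%N.
Proof.
move=> nP; elim: n => [|n IH] H; first by rewrite big_ord0 size_poly0 expr0 size_poly1.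
rewrite big_ord_recr /=; apply: leq_ltn_trans (size_polyD _ _) _.
have le : (size (P ^+ n) <= size (P ^+ n.+1))%N.
  by rewrite !size_polyXn_pdeg // ltnS leq_mul2l leqnSn orbT.
rewrite gtn_max; apply/andP; split.
  by apply: leq_trans (IH _) le => j /ltnW /H.
have [->|ne] := eqVneq (e n) 0; first by rewrite mul0r size_poly0 size_poly_gt0 expf_neq0.
have := H n (ltnSn n).
rewrite size_mul ?expf_neq0 // !size_polyXn_pdeg // (size_pdeg nP) addnS /= !ltnS mulnS.
by rewrite leq_add2r.
Qed.

(** Division by P^j discards the terms below j, whose sum has degree less than that of P^j;
    reduction modulo P then discards the terms above j. *)
Lemma qcoef_unique P f (e : nat -> {poly K}) n : P != 0 ->
  (forall j, (j < n)%N -> (size (e j) < size P)%N) ->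
  f = \sum_(j < n) e j * P ^+ j ->
  forall j, qcoef P f j = if (j < n)%N then e j else 0.
Proof.
move=> nP sz -> j; rewrite /qcoef.
have nPj : P ^+ j != 0 by rewrite expf_neq0.
case: ltnP => jn; last first.
  rewrite divp_small ?mod0p // (leq_trans (size_sum_expansion nP sz)) //.
  by rewrite !size_polyXn_pdeg // ltnS leq_mul2l jn orbT.
have [m ->] : exists m, n = (j + m.+1)%N.
  by exists (n - j).-1; rewrite prednK ?subn_gt0 // subnKC // ltnW.
rewrite big_split_ord /=.
have -> : \sum_(i < m.+1) e (j + i)%N * P ^+ (j + i) =
          (\sum_(i < m.+1) e (j + i)%N * P ^+ i) * P ^+ j.
  by rewrite mulr_suml; apply: eq_bigr => i _; rewrite exprD mulrCA mulrC.
rewrite addrC divp_addl_mul_small ?size_sum_expansion //; last first.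
  by move=> i ij; apply: sz; apply: ltn_trans ij jn.
rewrite big_ord_recl /= addn0 expr0 mulr1.
have -> : \sum_(i < m) e (j + bump 0 i)%N * P ^+ bump 0 i =
          (\sum_(i < m) e (j + bump 0 i)%N * P ^+ i) * P.
  by rewrite mulr_suml; apply: eq_bigr => i _; rewrite -mulrA -exprSr.
by rewrite addrC modp_addl_mul_small ?sz.
Qed.

Lemma qcoef_eq0 P f a j : P != 0 -> (size f <= a * pdeg P)%N -> (a <= j)%N ->
  qcoef P f j = 0.
Proof.
move=> nP sf aj; rewrite /qcoef divp_small ?mod0p // size_polyXn_pdeg // ltnS.
by apply: leq_trans sf _; rewrite mulnC leq_mul2l aj orbT.
Qed.

Lemma size_qcoef P f j : P != 0 -> (size (qcoef P f j) < size P)%N.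
Proof. by move=> nP; rewrite ltn_modp. Qed.

(** The number of terms may be any a with deg f < a deg P, because the coefficients from index a on
    vanish. *)
Lemma qcoef_sum P f a : (1 < size P)%N -> (size f <= a * pdeg P)%N ->
  f = \sum_(j < a) qcoef P f j * P ^+ j.
Proof.
move=> sP sf; have nP : P != 0 by rewrite -size_poly_gt0 ltnW.
have [E _] := qcoef_expansion f sP.
have W m k : (forall j, (m <= j)%N -> qcoef P f j = 0) -> (m <= k)%N ->
  \sum_(j < k) qcoef P f j * P ^+ j = \sum_(j < m) qcoef P f j * P ^+ j.
  move=> H /subnKC <-; rewrite big_split_ord /= [X in _ + X]big1 ?addr0 // => i _.
  by rewrite H ?mul0r // leq_addr.
rewrite {1}E; case: (leqP a (size f)) => h.
  by apply: W h => j; apply: qcoef_eq0.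
symmetry; apply: W (ltnW h) => j; apply: qcoef_eq0 => //.
by rewrite leq_pmulr // -ltnS -size_pdeg.
Qed.

(** At the top index the reduction modulo P does nothing, and the quotient of a monic polynomial by
    a monic one of no larger degree is monic. *)
Lemma qcoef_top_monic P f : (1 < size P)%N -> P \is monic -> f \is monic ->
  qcoef P f (pdeg f %/ pdeg P) \is monic.
Proof.
move=> sP mP mf; have nP := monic_neq0 mP; have nf := monic_neq0 mf.
set J := (_ %/ _)%N; have dP : (0 < pdeg P)%N by rewrite -ltnS -size_pdeg.
have mPJ : P ^+ J \is monic by rewrite monic_exp.
have szJ : (size (P ^+ J) <= size f)%N.
  by rewrite size_polyXn_pdeg // size_pdeg // ltnS mulnC leq_divM.
have -> : qcoef P f J = f %/ P ^+ J.
  rewrite /qcoef modp_small // size_divp ?monic_neq0 // (size_polyXn_pdeg _ nP) /=.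
  rewrite !size_pdeg // (divn_eq (pdeg f) (pdeg P)) -/J mulnC -addnS addKn ltnS.
  exact: ltn_pmod.
have nq : f %/ P ^+ J != 0 by rewrite divp_eq0 !negb_or nf monic_neq0 //= -leqNgt.
rewrite monicE -(eqP mf) {2}(divp_eq f (P ^+ J)) lead_coefDl ?lead_coef_Mmonic //.
rewrite size_Mmonic //; apply: leq_trans (_ : size (P ^+ J) <= _)%N.
  by rewrite ltn_modp monic_neq0.
by rewrite (size_pdeg nq) addSn /= leq_addl.
Qed.

End Expansions.

(** * The graded algebra *)

Section Graded.
Variables (L : fieldType) (V : orderedQSpace) (nu : valuation L V).
Implicit Types (x y : L) (b c : V).
Local Notation cls := (gr_class nu).
Local Notation pi := (\pi_({ideal_quot (@in_rees_gt L V nu)})%qT).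

Lemma val_geD b x y : x \in val_ge nu b -> y \in val_ge nu b -> x + y \in val_ge nu b.
Proof. by move=> xb yb; rewrite -[y]opprK val_geB // -sub0r val_geB ?val_ge0. Qed.

Lemma val_insub_single b y : y \in val_ge nu b ->
  val (insubd (0 : rees nu) (ga_single b y)) = ga_single b y.
Proof. by move=> yb; rewrite insubdK // ga_single_rees. Qed.

(** A homogeneous representative has b as its only possible degree, so membership in the ideal is
    tested in that degree alone. *)
Lemma gr_class_eq0 b y : y \in val_ge nu b -> (cls b y == 0) = (y \in val_gt nu b).
Proof.
move=> yb; rewrite /gr_class.
rewrite (_ : (0 : graded_alg nu) = pi 0); last by symmetry; exact: (rmorph0 pi).
rewrite -(Quotient.idealrBE (@in_rees_gt L V nu)) subr0.
apply/in_rees_gtP/idP => [/(_ b)|yb' c]; rewrite val_insub_single // monalg.mcoeffU.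
  by rewrite eqxx mulr1n.
by case: eqP => [<-|_]; rewrite ?mulr1n // val_gt0.
Qed.

Lemma gr_classD b x y : x \in val_ge nu b -> y \in val_ge nu b ->
  cls b (x + y) = cls b x + cls b y.
Proof.
move=> xb yb; have xyb := val_geD xb yb.
rewrite /gr_class -[RHS](rmorphD pi); congr pi.
by apply: val_inj; rewrite rmorphD /= !val_insub_single // /ga_single monalg.monalgUD.
Qed.

Lemma gr_classM b c x y : x \in val_ge nu b -> y \in val_ge nu c ->
  cls (b + c) (x * y) = cls b x * cls c y.
Proof.
move=> xb yc; have xyb := val_geM xb yc.
rewrite /gr_class -[RHS](rmorphM pi); congr pi.
apply: val_inj; rewrite rmorphM /= !val_insub_single //.
by rewrite -[RHS]/(ga_mul _ _) /ga_single ga_mulUU.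
Qed.

Lemma gr_class0 b : cls b 0 = 0.
Proof. by apply/eqP; rewrite gr_class_eq0 ?val_ge0 ?val_gt0. Qed.

Lemma gr_class_sum b (I : Type) (r : seq I) (P : pred I) (F : I -> L) :
  (forall i, P i -> F i \in val_ge nu b) ->
  cls b (\sum_(i <- r | P i) F i) = \sum_(i <- r | P i) cls b (F i).
Proof.
move=> H; have [//] : cls b (\sum_(i <- r | P i) F i) = \sum_(i <- r | P i) cls b (F i)
  /\ \sum_(i <- r | P i) F i \in val_ge nu b.
elim/big_ind2: _ => [|x u y v [xu xb] [yv yb]|i /H h]; last by [].
  by rewrite gr_class0 val_ge0.
by rewrite gr_classD // xu yv val_geD.
Qed.

Lemma val_ge_refl x : x \in val_ge nu (nu x).
Proof. by rewrite inE lexx orbT. Qed.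

Lemma initial_neq0 x : x != 0 -> initial nu x != 0.
Proof. by move=> nx; rewrite gr_class_eq0 ?val_ge_refl // inE (negPf nx) ltxx. Qed.

Lemma initialM x y : x != 0 -> y != 0 -> initial nu (x * y) = initial nu x * initial nu y.
Proof. by move=> nx ny; rewrite /initial valuationM // gr_classM ?val_ge_refl. Qed.

Lemma initial1 : initial nu 1 = 1.
Proof.
rewrite /initial valuation1 /gr_class -[RHS](rmorph1 pi); congr pi.
by apply: val_inj; rewrite val_insub_single ?rmorph1 // inE valuation1 lexx orbT.
Qed.

Lemma initialX x n : x != 0 -> initial nu (x ^+ n) = initial nu x ^+ n.
Proof.
move=> nx; elim: n => [|n IH]; first by rewrite !expr0 initial1.
by rewrite !exprS initialM ?expf_neq0 // IH.
Qed.

Lemma gr_class_initial b y : y \in val_ge nu b ->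
  cls b y = if (y != 0) && (nu y == b) then initial nu y else 0.
Proof.
move=> yb; case: ifP => [/andP[_ /eqP <-] //|h]; apply/eqP; rewrite gr_class_eq0 //.
move: yb h; rewrite !inE; case: eqP => //= _.
by rewrite le_eqVlt eq_sym => /orP[->|].
Qed.

Lemma homogeneous1 : homogeneous (1 : graded_alg nu).
Proof.
by exists 0, 1; split; [rewrite inE valuation1 lexx orbT | rewrite -initial1 /initial valuation1].
Qed.

End Graded.

Lemma generated_subringI (G : comNzRingType) (S : set G) : S `<=` generated_subring S.
Proof. by move=> u Su P SP _ _ _; apply: SP. Qed.

Section GeneratedSubring.
Variables (G : comNzRingType) (S : set G).
Local Notation A := (generated_subring S).

Lemma generated_subring1 : A 1. Proof. by move=> P _ P1. Qed.

Lemma generated_subringB u v : A u -> A v -> A (u - v).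
Proof. by move=> Au Av P SP P1 PB PM; apply: (PB); [exact: Au | exact: Av]. Qed.

Lemma generated_subringM u v : A u -> A v -> A (u * v).
Proof. by move=> Au Av P SP P1 PB PM; apply: (PM); [exact: Au | exact: Av]. Qed.

Lemma generated_subring0 : A 0.
Proof. by rewrite -(subrr 1); apply: generated_subringB; exact: generated_subring1. Qed.

Lemma generated_subringD u v : A u -> A v -> A (u + v).
Proof.
move=> Au Av; rewrite -[v]opprK; apply: generated_subringB => //.
by rewrite -sub0r; apply: generated_subringB => //; exact: generated_subring0.
Qed.

Lemma generated_subringX u n : A u -> A (u ^+ n).
Proof.
move=> Au; elim: n => [|n IH]; first by rewrite expr0; exact: generated_subring1.
by rewrite exprS; apply: generated_subringM.
Qed.

Lemma generated_subring_sum (I : Type) (r : seq I) (P : pred I) (F : I -> G) :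
  (forall i, P i -> A (F i)) -> A (\sum_(i <- r | P i) F i).
Proof.
by move=> H; apply: (big_ind A); [exact: generated_subring0 | exact: generated_subringD | ].
Qed.

Lemma generated_subring_prod (I : Type) (r : seq I) (P : pred I) (F : I -> G) :
  (forall i, P i -> A (F i)) -> A (\prod_(i <- r | P i) F i).
Proof.
by move=> H; apply: (big_ind A); [exact: generated_subring1 | exact: generated_subringM | ].
Qed.

End GeneratedSubring.

Lemma sub_star (L : fieldType) (V : orderedQSpace) (nu : valuation L V)
    (S : set (graded_alg nu)) : S 1 -> S `<=` star S.
Proof.
move=> S1 u Su; exists u, 1; split=> //; last by rewrite mulr1.
  exact: homogeneous1.
exact: oner_neq0.
Qed.

(** * Indices and standard exponents *)

Section WellOrder.
Variables (disp : Order.disp_t) (Lam : bOrderType disp).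
Hypothesis wo : wochoice.well_order (<=%O : rel Lam).
Implicit Types (i j k p q : Lam).

(** Passes from boolean predicates, in which well-ordering is phrased, to arbitrary sets. *)
Lemma wo_min (P : set Lam) : (exists x, P x) ->
  exists2 m, P m & forall x, P x -> (m <= x)%O.
Proof.
case=> x Px; have [|m [[mP mm] _]] := wo (A := [pred x | `[< P x >]]).
  by exists x; exact/asboolP.
exists m; first exact/asboolP.
by move=> y Py; apply: mm; exact/asboolP.
Qed.

Lemma wo_ind (P : set Lam) : (forall i, (forall j, (j < i)%O -> P j) -> P i) ->
  forall i, P i.
Proof.
move=> H i; apply: contrapT => nPi.
have [m nPm mm] := @wo_min [set x | ~ P x] (ex_intro _ i nPi).
by apply: nPm; apply: H => j jm; apply: contrapT => /mm; rewrite leNgt jm.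
Qed.

Lemma is_succ_unique i j k : is_succ i j -> is_succ i k -> j = k.
Proof. by move=> [ij Hj] [ik Hk]; apply/eqP; rewrite eq_le Hj // Hk. Qed.

Lemma lsucc_is_succ i k : (i < k)%O -> is_succ i (lsucc i).
Proof.
move=> ik; have [j ij jm] := @wo_min [set x | (i < x)%O] (ex_intro _ k ik).
by apply: (@xgetPex _ i [set j | is_succ i j]); exists j.
Qed.

Lemma lsucc_eq i j : is_succ i j -> lsucc i = j.
Proof. by move=> s; apply: (is_succ_unique _ s); apply: (@lsucc_is_succ i j); case: s. Qed.

Lemma shiftS i t : shift i t.+1 = lsucc (shift i t).
Proof. by []. Qed.

Lemma shift_shift i s t : shift (shift i s) t = shift i (t + s).
Proof. by rewrite /shift iterD. Qed.

Section PlusOmega.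
Variables (i k : Lam).
Hypothesis om : is_plus_omega i k.

Lemma plus_omega_lt t : (shift i t < k)%O. Proof. by case: om. Qed.

Lemma plus_omega_succ t : is_succ (shift i t) (shift i t.+1).
Proof. by rewrite shiftS; apply: lsucc_is_succ (plus_omega_lt t). Qed.

Lemma shift_le s t : (s <= t)%N -> (shift i s <= shift i t)%O.
Proof.
move=> /subnK <-; elim: (t - s)%N => [|u IH] //.
by rewrite addSn; apply: le_trans IH _; apply: ltW; case: (plus_omega_succ (u + s)).
Qed.

Lemma plus_omega_shift t : is_plus_omega (shift i t) k.
Proof.
split=> [u|m Hm]; first by rewrite shift_shift plus_omega_lt.
apply: (om.2) => u; apply: le_lt_trans (Hm u).
by rewrite shift_shift shift_le // leq_addr.
Qed.

(** Take the least t with j at most i + t: if t is a successor, j exceeds the previous shift and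
    hence reaches the next one. *)
Lemma plus_omega_below j : (i <= j)%O -> (j < k)%O -> exists t, j = shift i t.
Proof.
move=> ij jk; have /existsNP[t0 /negP] : ~ forall t, (shift i t < j)%O.
  by move=> /om.2; rewrite leNgt jk.
rewrite -leNgt => h0; have ex : exists t, (j <= shift i t)%O by exists t0.
case: (ex_minnP ex) => -[|t] jt tm; first by exists 0%N; apply/eqP; rewrite eq_le ij jt.
exists t.+1; apply/eqP; rewrite eq_le jt /=; apply: (plus_omega_succ t).2.
by rewrite ltNge; apply/negP => /tm; rewrite ltnn.
Qed.

Lemma plus_omega_ge j : (i <= j)%O -> (j < k)%O -> is_plus_omega j k.
Proof. by move=> ij jk; have [t ->] := plus_omega_below ij jk; apply: plus_omega_shift. Qed.

Lemma plus_omega_limit p : is_succ p k -> False.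
Proof.
move=> [pk pm]; have [ip|pi] := leP i p.
  have [t pt] := plus_omega_below ip pk.
  have := plus_omega_lt t.+1; rewrite ltNge; case/negP; apply: pm.
  by rewrite pt; case: (plus_omega_succ t).
by have := plus_omega_lt 0; rewrite ltNge; case/negP; apply: pm.
Qed.

End PlusOmega.

Lemma plus_omega_unique i j k : is_plus_omega i j -> is_plus_omega i k -> j = k.
Proof.
by move=> [aj mj] [ak mk]; apply/eqP; rewrite eq_le mj // mk.
Qed.

Lemma plus_omega_lsucc i k : (i < k)%O -> is_plus_omega (lsucc i) k -> is_plus_omega i k.
Proof.
move=> ik om; have shE t : shift (lsucc i) t = shift i t.+1 by rewrite /shift iterSr.
split=> [[//|t]|m H]; first by rewrite -shE plus_omega_lt.
by apply: om.2 => t; rewrite shE.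
Qed.

Variable alpha : Lam -> nat.
Hypothesis alpha_gt0 : forall i, (0 < alpha i)%N.

Lemma inessential_shift D i t : inessential alpha D i -> inessential alpha D (shift i t).
Proof.
move=> [[k Dk om] a1]; split; first by exists k => //; apply: plus_omega_shift.
by move=> u; rewrite shift_shift.
Qed.

Lemma inessential_sub D D' i : D `<=` D' -> inessential alpha D i -> inessential alpha D' i.
Proof. by move=> sub [[k Dk om] a1]; split=> //; exists k => //; apply: sub. Qed.

Lemma inessential_alpha D q : inessential alpha D q -> alpha (lsucc q) = 1%N.
Proof. by case=> _ /(_ 1%N). Qed.

(* This is [p+ = i], with [p+] computed in [upto i]. *)
Definition step p i :=
  is_succ p i \/ (is_plus_omega p i /\ forall t, alpha (shift p t) = 1%N).

Lemma step_lt p i : step p i -> (p < i)%O.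
Proof. by case=> [[]|[[/(_ 0%N)]]]. Qed.

Lemma upto_trans i j : (i <= j)%O -> upto i `<=` upto j.
Proof. by move=> ij q /le_trans; apply. Qed.

(** When i is the successor of p, the limit p + omega lies beyond i, so p is not inessential in
    [upto i]. *)
Lemma step_is_plus p i : step p i -> is_plus alpha (upto i) p i.
Proof.
case=> [s|[om a1]]; split; rewrite /upto /mkset ?lexx //; last first.
  by left; split=> //; split=> //; exists i => //; exact: lexx.
right; split=> // -[[k ki om] _].
have le : (i <= k)%O by apply: s.2; have := plus_omega_lt om 0.
have e : k = i by apply/eqP; rewrite eq_le le andbT.
by subst k; exact: plus_omega_limit om _ s.
Qed.

(** A limit is never a successor, so an index that shares i+ with an inessential i is itself
    inessential with the same omega-limit. *)
Lemma standardP l g : standard alpha l g <->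
  [/\ (forall i, g i != 0%N -> (i <= l)%O),
      (forall i j, (i < l)%O -> is_plus alpha (upto l) i j -> (g i < alpha j)%N) &
      (forall i j k, inessential alpha (upto l) i -> inessential alpha (upto l) j ->
         is_plus_omega i k -> is_plus_omega j k ->
         g i != 0%N -> g j != 0%N -> i = j)].
Proof.
split=> -[H1 H2 H3]; split=> //.
  move=> i j k ei ej oi oj gi gj; have kl : (k <= l)%O.
    by case: ei => -[k' kl' om'] _; rewrite (plus_omega_unique oi om').
  apply: (H3 i ei) => //; exists k; split; split=> //; by left.
move=> i ei j k [u [[ul pj] [_ pi]]] [v [[vl pk] [_ pi']]].
have ou : is_plus_omega i u by case: pi => [[]|[]].
have ov : is_plus_omega i v by case: pi' => [[]|[]].
rewrite (plus_omega_unique ov ou) in pk.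
have ej : inessential alpha (upto l) j /\ is_plus_omega j u.
  by case: pj => [//|[_ /(plus_omega_limit ou)]].
have ek : inessential alpha (upto l) k /\ is_plus_omega k u.
  by case: pk => [//|[_ /(plus_omega_limit ou)]].
by case: ej ek => ej oj [ek ok]; apply: (H3 j k u).
Qed.

(** * Standard exponents for p and for i when p+ = i *)

Section Step.
Variables (p i : Lam).
Hypothesis st : step p i.

Let pi := step_lt st.

(** Shrinking the index set from [upto i] to [upto p] changes q+ only if the omega-limit of q lies
    above p; then p lies in the same omega-block, whose limit can only be i. *)
Lemma step_is_plus_down q r : (q < p)%O -> is_plus alpha (upto i) q r ->
  is_plus alpha (upto p) q r \/
  [/\ r = i, is_plus_omega q i & inessential alpha (upto i) q].
Proof.
move=> qp [ri [[eq oq]|[nq sq]]]; last first.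
  left; split; first by rewrite /upto /mkset; apply: sq.2.
  by right; split=> // /(inessential_sub (upto_trans (ltW pi))).
have [rp|pr] := leP r p.
  left; split=> //; left; split=> //; split; last by case: eq.
  by exists r.
have op := plus_omega_ge oq (ltW qp) pr.
have e : r = i.
  case: st => [s|[om _]]; last exact: plus_omega_unique op om.
  by apply/eqP; rewrite eq_le ri /=; apply: s.2.
by right; split=> //; rewrite -e.
Qed.

Lemma step_is_plus_up q r : (q < p)%O -> is_plus alpha (upto p) q r ->
  is_plus alpha (upto i) q r \/
  [/\ r = lsucc q, is_plus_omega q i & inessential alpha (upto i) q].
Proof.
move=> qp [rp [[eq oq]|[nq sq]]].
  left; split; first exact: upto_trans (ltW pi) _ rp.
  by left; split=> //; apply: inessential_sub eq; apply: upto_trans (ltW pi).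
have [eq|neq] := pselect (inessential alpha (upto i) q); last first.
  by left; split; [exact: upto_trans (ltW pi) _ rp | right].
have [k ki oq] := eq.1.
have [[pk [[ep op]|[_ sk]]]|[e o _]] := step_is_plus_down qp (conj ki (or_introl (conj eq oq))).
- by case: nq.
- by case: (plus_omega_limit oq sk).
by right; split=> //; rewrite ?(lsucc_eq sq) // -e.
Qed.

(** In [upto p] the limit i is absent, so there q+ is q + 1 and the exponent at q is less than
    [alpha (lsucc q)], which is 1. *)
Lemma standard_block q g : (q < p)%O -> is_plus_omega q i ->
  inessential alpha (upto i) q -> standard alpha p g -> g q = 0%N.
Proof.
move=> qp oq eq [_ H _]; have sq := plus_omega_succ oq 0.
have := H q (lsucc q) qp.
rewrite (inessential_alpha eq) ltnS leqn0 => h; apply/eqP/h; split.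
  by rewrite /upto /mkset; apply: sq.2.
right; split=> // -[[k kp oq'] _]; move: kp.
by rewrite (plus_omega_unique oq' oq) /upto /mkset leNgt pi.
Qed.

(** By [standard_block], g vanishes at the indices below p in the omega-block of i, so a new
    exponent at p respects the rule of one nonzero exponent per block. *)
Lemma standard_step_add (g g' : exponent Lam) (n : nat) : standard alpha p g ->
  (n < alpha i)%N -> (forall q, g' q = if q == p then n else g q) -> standard alpha i g'.
Proof.
move=> sg ki g'E; have gb := standard_block _ _ _ sg.
have /standardP[H1 H2 H3] := sg.
have supp q : g' q != 0%N -> (q <= p)%O.
  by rewrite g'E; case: (q =P p) => [->|_ /H1] //.
apply/standardP; split=> [q /supp qp|q r qi pr|j1 j2 r e1 e2 o1 o2 g1 g2].
- exact: le_trans qp (ltW pi).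
- have [pq|qp|epq] := ltgtP p q.
  + rewrite (_ : g' q = 0%N) ?alpha_gt0 //; apply/eqP.
    by apply: contraTT pq => /supp; rewrite -leNgt.
  + rewrite g'E (lt_eqF qp).
    have [/(H2 _ _ qp)//|[_ oq eq]] := step_is_plus_down qp pr.
    by rewrite gb.
  rewrite g'E -epq eqxx.
  suff -> : r = i by [].
  move: pr; rewrite -epq => -[ri [[ep op]|[np sp]]];
    case: (step_is_plus st) => _ [[ep' op']|[np' sp']] //.
  + exact: plus_omega_unique op op'.
  + exact: is_succ_unique sp sp'.
have ri : (r <= i)%O.
  by case: e1 => -[r' r'i o1'] _; rewrite (plus_omega_unique o1 o1').
have [rp|pr] := leP r p.
  have lt j : is_plus_omega j r -> (j < p)%O.
    by move=> oj; apply: lt_le_trans rp; have := plus_omega_lt oj 0.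
  have es j : is_plus_omega j r -> inessential alpha (upto i) j -> inessential alpha (upto p) j.
    by move=> oj [_ a1]; split=> //; exists r.
  move: g1 g2; rewrite !g'E (lt_eqF (lt _ o1)) (lt_eqF (lt _ o2)) => g1 g2.
  by apply: (H3 _ _ r) => //; apply: es.
have eqp j : is_plus_omega j r -> inessential alpha (upto i) j -> g' j != 0%N -> j = p.
  move=> oj ej gj; have jp := supp _ gj.
  apply/eqP; rewrite eq_le jp /= leNgt; apply/negP => lt.
  have op := plus_omega_ge oj jp pr.
  have er : r = i.
    case: st => [s|[om _]]; last exact: plus_omega_unique op om.
    by apply/eqP; rewrite eq_le ri /=; apply: s.2.
  by move: gj; rewrite g'E (lt_eqF lt) gb // -er.
by rewrite (eqp j1 o1 e1 g1) (eqp j2 o2 e2 g2).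
Qed.

(** Reverse passage: the power of Q_p is split off. The exponents in the block below p must vanish,
    since in [upto p] they are bounded by 1 instead of by [alpha i]. *)
Lemma standard_step_rem (g g' : exponent Lam) : standard alpha i g ->
  (forall q, (p < q)%O -> g q = 0%N) ->
  (forall q, (q < p)%O -> is_plus_omega q i -> inessential alpha (upto i) q -> g q = 0%N) ->
  (forall q, g' q = if q == p then 0%N else g q) ->
  standard alpha p g' /\ (g p < alpha i)%N.
Proof.
move=> /standardP[H1 H2 H3] g0 gb g'E; split; last first.
  by apply: H2 => //; apply: step_is_plus.
have sub : upto p `<=` upto i := upto_trans (ltW pi).
apply/standardP; split=> [q|q r qp pr|j1 j2 r e1 e2 o1 o2].
- by rewrite g'E; case: (q =P p) => // _; apply: contraR; rewrite -ltNge => /g0 ->.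
- rewrite g'E (lt_eqF qp); have [pr'|[_ oq eq]] := step_is_plus_up qp pr.
    by apply: H2 pr'; apply: lt_trans qp pi.
  by rewrite gb.
rewrite !g'E; case: (j1 =P p) => // _; case: (j2 =P p) => // _.
by apply: H3 (o1) (o2); apply: inessential_sub sub _.
Qed.

End Step.

(** For a successor, p is the predecessor. For a limit, p is the only index of the block that
    carries a nonzero exponent, or any index of the block if there is none. *)
Lemma standard_step_ex i g : (exists p, step p i) -> standard alpha i g -> g i = 0%N ->
  exists p, [/\ step p i, (forall q, (p < q)%O -> g q = 0%N) &
    (forall q, (q < p)%O -> is_plus_omega q i -> inessential alpha (upto i) q -> g q = 0%N)].
Proof.
move=> [p0 st0] /standardP[H1 H2 H3] gi.
have H1' q : (i <= q)%O -> g q = 0%N.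
  rewrite le_eqVlt => /orP[/eqP<-//|iq]; apply/eqP; apply: contraTT iq => /H1.
  by rewrite -leNgt.
case: (st0) => [s|[o0 a0]].
  exists p0; split=> // [q pq|q qp oq]; first by apply: H1'; apply: s.2.
  by case: (plus_omega_limit oq s).
have e0 : inessential alpha (upto i) p0 by split=> //; exists i => //; exact: lexx.
have blk p q : is_plus_omega p i -> inessential alpha (upto i) p -> (p <= q)%O -> (q < i)%O ->
    is_plus_omega q i /\ inessential alpha (upto i) q.
  move=> op ep pq qi; split; first exact: (plus_omega_ge op pq qi).
  by have [t ->] := plus_omega_below op pq qi; apply: inessential_shift.
have [[j [oj ej gj]]|H] := pselect (exists j, [/\ is_plus_omega j i,
    inessential alpha (upto i) j & g j != 0%N]).
  exists j; split=> [|q jq|q qj oq eq].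
  - by right; split=> //; case: ej.
  - case: (leP i q) => [/H1' //|qi]; apply/eqP/negPn/negP => gq.
    have [oq eq] := blk _ _ oj ej (ltW jq) qi.
    by move: jq; rewrite (H3 j q i) ?ltxx.
  - by apply/eqP/negPn/negP => gq; move: qj; rewrite (H3 q j i) ?ltxx.
have H' q : is_plus_omega q i -> inessential alpha (upto i) q -> g q = 0%N.
  by move=> oq eq; apply/eqP/negPn/negP => gq; apply: H; exists q.
exists p0; split=> // q; last by move=> _; exact: H'.
move=> pq; case: (leP i q) => [/H1' //|qi].
by have [oq eq] := blk _ _ o0 e0 (ltW pq) qi; apply: H'.
Qed.

End WellOrder.

(** * Combinations of standard monomials *)

Section Combinations.
Variables (K : fieldType) (V : orderedQSpace).
Variable nu : valuation {fraction {poly K}} V.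
Variables (disp : Order.disp_t) (Lam : bOrderType disp).
Variables (Q : Lam -> {poly K}).
Implicit Types (g : exponent Lam) (c : combination K Lam) (v : V).

Lemma mono_fset (A : {fset Lam}) g : (finsupp g `<=` A)%fset ->
  mono Q g = \prod_(i <- A) Q i ^+ g i.
Proof.
move=> sub; rewrite /mono; apply: (big_fset_incl _ sub) => i _ /fsfun_dflt ->.
by rewrite expr0.
Qed.

Lemma mono_with g g' p n : g p = 0%N ->
  (forall q, g' q = if q == p then n else g q) -> mono Q g' = mono Q g * Q p ^+ n.
Proof.
move=> gp g'E; pose A := (p |` (finsupp g `|` finsupp g'))%fset.
rewrite (@mono_fset A g) ?(@mono_fset A g').
- have pA : p \in A by rewrite !inE eqxx.
  rewrite !(big_fsetD1 p pA) /= gp expr0 mul1r g'E eqxx mulrC; congr (_ * _).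
  by apply: eq_big_seq => i; rewrite !inE g'E => /andP[/negPf -> _].
- by apply: fsubset_trans (fsubsetUr _ _); exact: fsubsetUr.
by apply: fsubset_trans (fsubsetUr _ _); exact: fsubsetUl.
Qed.

Lemma mono0 : mono Q [fsfun] = 1.
Proof. by rewrite /mono finsupp0 big_seq_fset0. Qed.

Lemma comb_poly_fset (A : {fset exponent Lam}) c : (finsupp c `<=` A)%fset ->
  comb_poly Q c = \sum_(g <- A) (c g)%:P * mono Q g.
Proof.
move=> sub; rewrite /comb_poly; apply: (big_fset_incl _ sub) => i _ /fsfun_dflt ->.
by rewrite polyC0 mul0r.
Qed.

(** Each monomial is only bounded below by v, which makes the property stable under sums; for v = nu
    f with f nonzero it forces the minimum to be the value of f. *)
Definition rep (P : exponent Lam -> Prop) v (f : {poly K}) :=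
  exists c : combination K Lam,
    [/\ forall g, g \in finsupp c -> P g,
        forall g, g \in finsupp c -> pge nu v ((c g)%:P * mono Q g) & comb_poly Q c = f].

Lemma rep0 P v : rep P v 0.
Proof.
exists [fsfun]; split=> [g|g|]; rewrite ?in_finsupp0 //.
by rewrite /comb_poly finsupp0 big_seq_fset0.
Qed.

Lemma repD P v f1 f2 : rep P v f1 -> rep P v f2 -> rep P v (f1 + f2).
Proof.
move=> [c1 [P1 v1 <-]] [c2 [P2 v2 <-]].
pose A := (finsupp c1 `|` finsupp c2)%fset.
pose c : combination K Lam := [fsfun g in A => c1 g + c2 g].
have cE g : c g = c1 g + c2 g.
  rewrite fsfun_fun; case: ifPn => //; rewrite inE negb_or => /andP[n1 n2].
  by rewrite !fsfun_dflt // addr0.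
have v' (c' : combination K Lam) :
    (forall g, g \in finsupp c' -> pge nu v ((c' g)%:P * mono Q g)) ->
    forall g, pge nu v ((c' g)%:P * mono Q g).
  move=> H g; case: (boolP (g \in finsupp c')) => [/H //|/fsfun_dflt ->].
  by rewrite polyC0 mul0r pge0.
have sub : (finsupp c `<=` A)%fset by apply: finsupp_sub.
exists c; split=> [g /(fsubsetP sub)|g _|].
- by rewrite inE => /orP[/P1|/P2].
- by rewrite cE polyCD mulrDl pgeD ?v'.
rewrite (comb_poly_fset sub) (@comb_poly_fset A c1) ?fsubsetUl //.
rewrite (@comb_poly_fset A c2) ?fsubsetUr // -big_split.
by apply: eq_bigr => g _; rewrite cE polyCD mulrDl.
Qed.

Lemma rep_sum P v (I : eqType) (r : seq I) (F : I -> {poly K}) :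
  (forall i, i \in r -> rep P v (F i)) -> rep P v (\sum_(i <- r) F i).
Proof.
move=> H; rewrite big_seq; apply: (big_ind (rep P v)) => //; [exact: rep0 | exact: repD].
Qed.

Lemma rep_mono (P : exponent Lam -> Prop) v a g :
  P g -> pge nu v (a%:P * mono Q g) -> rep P v (a%:P * mono Q g).
Proof.
move=> Pg va; pose c : combination K Lam := [fsfun h in [fset g]%fset => a].
have cg : c g = a by rewrite fsfun_fun inE eqxx.
have sub : (finsupp c `<=` [fset g])%fset by apply: finsupp_sub.
exists c; split.
- by move=> h /(fsubsetP sub); rewrite inE => /eqP ->.
- by move=> h /(fsubsetP sub); rewrite inE => /eqP ->; rewrite cg.
by rewrite (comb_poly_fset sub) big_seq_fset1 cg.
Qed.

End Combinations.

(** * Comparison with the Gauss valuation *)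

Section CoefficientBounds.
Variables (K : fieldType) (V : orderedQSpace).
Variable nu : valuation {fraction {poly K}} V.
Implicit Types (f g P : {poly K}) (v w C : V).
Local Notation pge := (pge nu).

(** This bounds the Gauss valuation of f, the least value of a coefficient, from below by v. *)
Definition cge v f := forall k : nat, pge v (f`_k)%:P.

Lemma cge0 v : cge v 0. Proof. by move=> k; rewrite coef0 pge0. Qed.

Lemma cge_trans v w f : v <= w -> cge w f -> cge v f.
Proof. by move=> vw H k; apply: pge_trans vw (H k). Qed.

Lemma cgeN v f : cge v f -> cge v (- f).
Proof. by move=> H k; rewrite coefN polyCN pgeN. Qed.

Lemma cgeD v f g : cge v f -> cge v g -> cge v (f + g).
Proof. by move=> Hf Hg k; rewrite coefD polyCD pgeD. Qed.

Lemma cgeB v f g : cge v f -> cge v g -> cge v (f - g).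
Proof. by move=> Hf Hg; apply: cgeD => //; apply: cgeN. Qed.

Lemma cgeM v w f g : cge v f -> cge w g -> cge (v + w) (f * g).
Proof.
move=> Hf Hg k; rewrite coefM rmorph_sum; apply: pge_sum => j _.
by rewrite /= polyCM pgeM.
Qed.

Lemma cge_monomial v (c : K) n : pge v c%:P -> cge v (c%:P * 'X^n).
Proof.
by move=> H k; rewrite coefCM coefXn; case: eqP; rewrite ?mulr1 ?mulr0 // pge0.
Qed.

Lemma cge_pge v f : 0 < nup nu 'X -> cge v f -> pge v f.
Proof.
move=> hx H; rewrite -[f]coefK poly_def; apply: pge_sum => k _.
rewrite -mul_polyC -[v]addr0; apply: pgeM => //.
by apply: pge_nup; rewrite nupX ?polyX_eq0 // ord_mulrn_ge0 // ltW.
Qed.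

Lemma cge_ex f : exists C, [/\ Gam0Q nu C, 0 <= C & cge (- C) f].
Proof.
elim/poly_ind: f => [|f c [C [GC C0 H]]].
  by exists 0; split=> //; [exact: (rational_hull0 (nuK nu)) | exact: cge0].
have [->|nc] := eqVneq c 0.
  exists C; split=> // k; rewrite addr0 coefMX; case: k => [|k] //=.
  exact: pge0.
exists (Order.max C (- nup nu c%:P)); split.
- by apply: rational_hull_max => //; apply: rational_hullN; apply: Gam0Q_const.
- by rewrite le_max C0.
move=> k; rewrite coefD coefMX coefC; case: k => [|k] /=.
  by rewrite add0r; apply: pge_nup; rewrite ord_leNl le_max lexx orbT.
by rewrite addr0; apply: pge_trans (H k); rewrite ord_leNl opprK le_max lexx.
Qed.

(** Every step of long division subtracts a monomial multiple of P, which costs at most C, and there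
    are at most N steps. *)
Lemma cge_divp_modp P C : P \is monic -> 0 <= C -> cge (- C) P ->
  forall N v f, (size f <= N)%N -> cge v f ->
  cge (v - C *+ N) (f %/ P) /\ cge (v - C *+ N) (f %% P).
Proof.
move=> mP C0 HP; have nP := monic_neq0 mP.
have le v N : v - C *+ N <= v.
  exact/ord_subr_le/ord_mulrn_ge0.
elim=> [|N IH] v f sf Hf.
  move: sf; rewrite leqn0 size_poly_eq0 => /eqP ->.
  by rewrite div0p mod0p; split; exact: cge0.
have [lt|ge] := ltnP (size f) (size P).
  rewrite divp_small // modp_small //; split; first exact: cge0.
  exact: cge_trans (le _ _) Hf.
(* One step of long division: M is the leading term of the quotient, and f' has smaller degree than
   f. *)
pose M := (lead_coef f)%:P * 'X^(size f - size P); pose f' := f - M * P.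
have HM : cge v M by apply: cge_monomial; exact: Hf.
have Hf' : cge (v - C) f'.
  by apply: cgeB; [apply: cge_trans Hf; exact: (le v 1%N) | exact: cgeM].
have nf : f != 0 by rewrite -size_poly_gt0 (leq_trans _ ge) // size_poly_gt0.
have sf' : (size f' <= N)%N.
  have sM : size (M * P) = size f.
    have nl : lead_coef f != 0 by rewrite lead_coef_eq0.
    rewrite /M size_Mmonic ?mulf_neq0 ?polyC_eq0 ?monic_neq0 ?monicXn //.
    by rewrite mul_polyC size_scale // size_polyXn addSn /= subnK.
  have le1 : (size f' <= size f)%N.
    by rewrite (leq_trans (size_polyD _ _)) // size_polyN sM maxnn.
  have c0 : f'`_(size f).-1 = 0.
    rewrite coefB -{2}sM -!lead_coefE lead_coef_Mmonic // /M mul_polyC lead_coefZ.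
    by rewrite lead_coefXn mulr1 subrr.
  have : (size f' <= (size f).-1)%N.
    apply/leq_sizeP => j; rewrite leq_eqVlt => /orP[/eqP <- //|lt].
    by apply: nth_default; rewrite (leq_trans le1) // -(prednK (_ : 0 < size f)%N) // size_poly_gt0.
  by move/leq_trans; apply; rewrite -ltnS prednK ?size_poly_gt0.
have [Hq Hr] := IH _ _ sf' Hf'.
have e : v - C - C *+ N = v - C *+ N.+1 by rewrite mulrS opprD addrA.
rewrite e in Hq Hr.
have fE : f = (M + f' %/ P) * P + f' %% P.
  by rewrite mulrDl -addrA -divp_eq addrC subrK.
rewrite fE divp_addl_mul_small ?modp_addl_mul_small ?ltn_modp //; split=> //.
by apply: cgeD => //; apply: cge_trans HM.
Qed.

(** The coefficient of index j takes j successive quotients and one remainder, each at a cost of N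
    C. *)
Lemma cge_qcoef P C N v f j : P \is monic -> 0 <= C -> cge (- C) P ->
  (size f <= N)%N -> cge v f -> cge (v - C *+ (N * j.+1)) (qcoef P f j).
Proof.
move=> mP C0 HP sf Hf; have H := cge_divp_modp mP C0 HP.
have sz (k : nat) : (size (f %/ P ^+ k)%R <= N)%N by apply: leq_trans sf; exact: leq_divp.
have e k : v - C *+ (N * k.+1) = v - C *+ (N * k) - C *+ N.
  by rewrite mulnS mulrnDr [C *+ N + _]addrC opprD addrA.
have Hq : cge (v - C *+ (N * j)) (f %/ P ^+ j).
  elim: j => [|j IH]; first by rewrite muln0 mulr0n subr0 expr0 divp1.
  by rewrite exprSr -divp_divl e; have [] := H _ _ _ (sz j) IH.
by rewrite e; have [] := H _ _ _ (sz j) Hq.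
Qed.

(* A bound for the values of monic polynomials makes [nu] and the Gauss
   valuation equivalent on polynomials of bounded degree. *)
Lemma pge_cge C n : 0 < nup nu 'X -> 0 <= C ->
  (forall f, f \is monic -> (size f <= n)%N -> nup nu f <= C) ->
  forall m, (m <= n)%N -> forall v f, (size f <= m)%N -> pge v f -> cge (v - C *+ m) f.
Proof.
move=> hx C0 HC; elim=> [|m IH] mn v f sf Hf.
  by move: sf; rewrite leqn0 size_poly_eq0 => /eqP ->; exact: cge0.
have e : v - C - C *+ m = v - C *+ m.+1 by rewrite mulrS opprD addrA.
have le1 w (k : nat) : w - C *+ k <= w.
  exact/ord_subr_le/ord_mulrn_ge0.
have [lt|] := leqP (size f) m.
  have H := IH (ltnW mn) v f lt Hf.
  by apply: cge_trans H; rewrite mulrS [C + _]addrC opprD addrA; exact: (le1 _ 1%N).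
move=> gt; have es : size f = m.+1 by apply/eqP; rewrite eqn_leq sf gt.
have nf : f != 0 by rewrite -size_poly_gt0 es.
have nl : lead_coef f != 0 by rewrite lead_coef_eq0.
pose c := lead_coef f; pose f1 := c^-1 *: f.
have fE : f = c%:P * f1 by rewrite mul_polyC scalerA mulfV // scale1r.
have mf1 : f1 \is monic by rewrite monicE lead_coefZ mulVf.
(* As f = c f1 with f1 monic, the value nu c = nu f - nu f1 is at least v - C. Removing the leading
   term then lowers the degree at a loss of C. *)
have Hc : pge (v - C) c%:P.
  apply: pge_nup; rewrite -ord_lebl; apply: le_trans (nup_ge nf Hf) _.
  rewrite {1}fE nupM ?polyC_eq0 ?monic_neq0 // ord_leD2lE HC //.
  by rewrite size_scale ?invr_eq0 // es.
pose f' := f - c%:P * 'X^m.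
have Hf' : pge (v - C) f'.
  apply: pgeB; first by apply: pge_trans Hf; exact: (le1 v 1%N).
  rewrite -[v - C]addr0; apply: pgeM => //.
  by apply: pge_nup; rewrite nupX ?polyX_eq0 // ord_mulrn_ge0 // ltW.
have sf' : (size f' <= m)%N.
  apply/leq_sizeP => j; rewrite coefB coefCM coefXn leq_eqVlt => /orP[/eqP <-|lt].
    by rewrite eqxx mulr1 /c lead_coefE es subrr.
  by rewrite gtn_eqF // mulr0 subr0 nth_default // es.
rewrite -[f](subrK (c%:P * 'X^m)) -/f' -e; apply: cgeD.
  exact: IH (ltnW mn) _ _ sf' Hf'.
by apply: cge_trans (le1 _ _) _; apply: cge_monomial.
Qed.

End CoefficientBounds.

(** * Hasse derivatives *)

Section HasseDerivatives.
Variable K : fieldType.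
Implicit Types (h : {poly K}) (p q e m n b : nat).

(** The Taylor expansion at a is an expansion in powers of x - a with constant coefficients, and
    expansions are unique. *)
Lemma qcoef_taylor (a : K) h j : qcoef ('X - a%:P) h j = (h^`N(j).[a])%:P.
Proof.
have sz k : (size (h^`N(k).[a])%:P < size ('X - a%:P)%R)%N.
  by rewrite size_XsubC ltnS size_polyC leq_b1.
rewrite (@qcoef_unique _ ('X - a%:P) h (fun j => (h^`N(j).[a])%:P) (size h)) //.
- by case: ltnP => // sj; rewrite nderivn_poly0 // horner0.
- exact/monic_neq0/monicXsubC.
have := nderiv_taylor (map_poly polyC h) (mulrC a%:P ('X - a%:P)).
rewrite [a%:P + _]addrC subrK size_map_polyC => E.
rewrite -{1}[h]comp_polyXr /comp_poly E; apply: eq_bigr => i _.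
by rewrite nderivn_map horner_map.
Qed.

Lemma coef_exp1DX n i : ((1 + 'X) ^+ n : {poly K})`_i = 'C(n, i)%:R.
Proof.
rewrite exprDn coef_sum; have [lt|ge] := ltnP i n.+1; last first.
  rewrite bin_small // big1 // => j _; rewrite expr1n mul1r coefMn coefXn.
  by rewrite gtn_eqF ?mul0rn // (leq_trans (ltn_ord j)).
rewrite (bigD1 (Ordinal lt)) //= expr1n mul1r coefMn coefXn eqxx big1 ?addr0 //.
move=> j nj; rewrite expr1n mul1r coefMn coefXn eq_sym.
by rewrite (_ : (j == i :> nat) = false) ?mul0rn //; apply: negbTE.
Qed.

(** Compare coefficients in (1 + x)^(q m) = (1 + x^q)^m for q = p^e. *)
Lemma bin_pchar p e m b : p \in [pchar K] ->
  'C(p ^ e * m, b)%:R = (if (p ^ e %| b)%N then 'C(m, b %/ p ^ e)%:R else 0) :> K.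
Proof.
move=> pc; have pp := pcharf_prime pc; set q := (p ^ e)%N.
have q0 : (0 < q)%N by rewrite expn_gt0 prime_gt0.
have pcP : p \in [pchar {poly K}] by rewrite pchar_poly.
have E : (1 + 'X) ^+ (q * m) = ((1 + 'X) ^+ m) \Po 'X^q :> {poly K}.
  rewrite exprM exprDn_pchar ?expr1n; last by rewrite pnatX pnatE // pcP.
  by rewrite rmorphXn rmorphD rmorph1 /= comp_polyX.
by rewrite -coef_exp1DX E coef_comp_poly_Xn // coef_exp1DX.
Qed.

Lemma comp_polyXn_dvd h d : (0 < d)%N -> (forall k, h`_k != 0 -> (d %| k)%N) ->
  exists g, h = g \Po 'X^d.
Proof.
move=> d0 H; exists (\poly_(i < size h) h`_(d * i)); apply/polyP => k.
rewrite coef_comp_poly_Xn //; case: ifP => dk.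
  rewrite coef_poly [(d * _)%N]mulnC divnK //; case: ltnP => // le.
  by rewrite nth_default // (leq_trans le) // leq_div.
by apply/eqP; apply: contraFT dk => /H.
Qed.

(* In characteristic p, the least b >= 1 with h^`N(b) <> 0 is the largest power of p
   dividing all exponents of h. *)
Lemma comp_polyXn_nderivn h d : (0 < d)%N -> h^`N(d) != 0 ->
  (forall b, (0 < b < d)%N -> h^`N(b) = 0) -> exists g, h = g \Po 'X^d.
Proof.
move=> d0 nd H; apply: comp_polyXn_dvd => // k0 nk0.
(* The leading coefficient of the d-th Hasse derivative is a nonzero binomial multiple of a
   coefficient of h; k is the index of that coefficient. *)
have [k [dk nk ck]] : exists k, [/\ (d <= k)%N, h`_k != 0 & 'C(k, d)%:R != 0 :> K].
  have := lead_coef_eq0 (h^`N(d)); rewrite (negPf nd) lead_coefE coef_nderivn -mulr_natr.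
  set i := _.-1 => /negbT; rewrite mulf_eq0 negb_or => /andP[h1 h2].
  by exists (d + i)%N; rewrite leq_addr.
have Hb b j : (0 < b < d)%N -> (b <= j)%N -> h`_j != 0 -> 'C(j, b)%:R = 0 :> K.
  move=> bd /subnKC e nj; apply/eqP.
  have /polyP/(_ (j - b)%N) := H b bd; rewrite coef_nderivn coef0 e -[h`_j *+ _]mulr_natr.
  by move/eqP; rewrite mulf_eq0 (negPf nj).
have [[p pc]|c0] := pselect (exists p, p \in [pchar K]); last first.
  suff -> : d = 1%N by [].
  apply/eqP; rewrite eqn_leq d0 andbT leqNgt; apply/negP => d1.
  (* In characteristic 0, d > 1 would make the first derivative vanish, hence k = 0 in K with k >
     0. *)
  have /eqP := Hb 1%N k d1 (leq_trans d0 dk) nk; rewrite bin1.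
  have /pcharf0P -> : [pchar K] =i pred0.
    by move=> p; rewrite [RHS]inE; apply/negbTE/negP => pc; apply: c0; exists p.
  by rewrite -leqn0 leqNgt (leq_trans d0 dk).
have pp := pcharf_prime pc.
(* For q = p^e < d the q-th derivative vanishes, and the binomial of (q m, q) equals m in K, so p
   divides m for each exponent q m of h. *)
have step e : (p ^ e < d)%N -> (forall j, h`_j != 0 -> (p ^ e %| j)%N) ->
    forall j, h`_j != 0 -> (p ^ e.+1 %| j)%N.
  move=> ed He [|j] nj; first by rewrite dvdn0.
  have q0 : (0 < p ^ e)%N by rewrite expn_gt0 prime_gt0.
  have /dvdnP[m jE] := He _ nj; have := Hb (p ^ e)%N _ _ _ nj.
  rewrite q0 ed (dvdn_leq _ (He _ nj)) // => /(_ isT isT).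
  rewrite jE mulnC bin_pchar // dvdnn divnn q0 bin1 => /eqP.
  by rewrite -(dvdn_pcharf pc) expnSr => /(dvdn_mul (dvdnn (p ^ e))).
have pow e : (p ^ e <= d)%N -> forall j, h`_j != 0 -> (p ^ e %| j)%N.
  elim: e => [|e IH] ed; first by move=> j _; rewrite expn0 dvd1n.
  have lt : (p ^ e < d)%N by rewrite (leq_trans _ ed) // ltn_exp2l // prime_gt1.
  exact: step lt (IH (ltnW lt)).
have /andP[le lt] := trunc_log_bounds (prime_gt1 pp) d0.
move: le lt; set e := trunc_log p d; rewrite leq_eqVlt => /orP[/eqP e1|e1] e2.
  by rewrite -e1 pow // e1.
(* If p^e < d < p^(e+1), then p^(e+1) divides k but not d, so the binomial of (k, d) vanishes in K,
   against the choice of k. *)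
have /dvdnP[m kE] := step e e1 (pow e (ltnW e1)) k nk.
move: ck; rewrite kE mulnC bin_pchar // gtnNdvd ?eqxx //.
Qed.

End HasseDerivatives.

(** * Key polynomials *)

Section KeyPolynomialTheory.
Variables (K : fieldType) (V : orderedQSpace).
Variable nu : valuation {fraction {poly K}} V.
Variables (disp : Order.disp_t) (Lam : bOrderType disp).
Variables (alpha : Lam -> nat) (Q : Lam -> {poly K}).
Hypothesis wo : wochoice.well_order (<=%O : rel Lam).
Hypothesis prekey : prekey_polynomials alpha Q.
Hypothesis ksucc : key_successor nu alpha Q.
Hypothesis klim : key_limit nu alpha Q.
Implicit Types (i l p : Lam) (f : {poly K}).
Local Notation nup := (nup nu).
Local Notation pge := (pge nu).
Local Notation pgt := (pgt nu).

Definition nonmax i := exists k, (i < k)%O.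

Lemma key_monic i : Q i \is monic. Proof. by case: prekey. Qed.
Lemma key_neq0 i : Q i != 0. Proof. exact/monic_neq0/key_monic. Qed.
Lemma key_alpha i : (0 < alpha i)%N. Proof. by case: prekey => _ _ []. Qed.
Lemma key_bot : Q \bot%O = 'X. Proof. by case: prekey. Qed.
Lemma nonmax_lt i k : (i < k)%O -> nonmax i. Proof. by exists k. Qed.

Lemma mono_monic (g : exponent Lam) : mono Q g \is monic.
Proof. by apply: monic_prod => i _; rewrite monic_exp // key_monic. Qed.

Lemma mono_neq0 (g : exponent Lam) : mono Q g != 0.
Proof. exact/monic_neq0/mono_monic. Qed.

Lemma is_plus_step p i : is_plus alpha setT p i -> step alpha p i.
Proof. by move=> [_ [[[_ a1] om]|[_ s]]]; [right | left]. Qed.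

Lemma step_limit_plus p i : (forall q, ~ is_succ q i) -> step alpha p i ->
  is_plus alpha setT p i.
Proof.
move=> lim [s|[om a1]]; first by case: (lim p).
by split=> //; left; split=> //; split=> //; exists i.
Qed.

Lemma step_ex i : i != \bot%O -> exists p, step alpha p i.
Proof.
move=> ib; have [[p s]|lim] := pselect (exists p, is_succ p i).
  by exists p; left.
have [|[p pl] _ _ _] := klim ib; last by exists p; apply: is_plus_step.
by move=> p s; apply: lim; exists p.
Qed.

(** * Degrees of key polynomials and of free standard monomials *)

Definition free_exponent l (g : exponent Lam) := standard alpha l g /\ g l = 0%N.

Definition small_monomials l :=
  (1 < size (Q l))%N /\
  forall g, free_exponent l g -> (size (mono Q g) < size (Q l))%N.

Lemma size_comb_poly l c : small_monomials l -> free_standard nu alpha Q l c ->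
  (size (comb_poly Q c) < size (Q l))%N.
Proof.
move=> [s1 sm] [sc _]; rewrite /comb_poly big_seq.
apply: (big_ind (fun f : {poly K} => (size f < size (Q l))%N)).
- by rewrite size_poly0 ltnW.
- by move=> f1 f2 h1 h2; apply: leq_ltn_trans (size_polyD _ _) _; rewrite gtn_max h1.
move=> g /sc /sm; apply: leq_ltn_trans; rewrite mul_polyC; exact: size_scale_leq.
Qed.

Lemma size_key_gt1 l : (1 < size (Q l))%N = (0 < pdeg (Q l))%N.
Proof. by rewrite size_pdeg ?key_neq0. Qed.

(** The degree condition on pre-key polynomials uses p+ in the whole index set, which may be p +
    omega even if i = p + 1; for successors the degree is therefore read off the expansion of
    Q_i. *)
Lemma pdeg_step p i : nonmax i -> small_monomials p -> step alpha p i ->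
  pdeg (Q i) = (alpha i * pdeg (Q p))%N.
Proof.
move=> ni sp st; have [[q s]|lim] := pselect (exists q, is_succ q i); last first.
  have [_ _ _] := prekey; apply=> //; first exact: step_lt st.
  by apply: step_limit_plus => // q s; apply: lim; exists q.
have sp' : is_succ p i by case: st => [//|[om _]]; case: (plus_omega_limit wo om s).
have [c [cf -> _ _]] := ksucc sp'.
have lt := size_sum_expansion (key_neq0 p) (fun j ja => size_comb_poly sp (cf j ja)).
by rewrite /pdeg size_polyDl // size_polyXn_pdeg ?key_neq0 //= mulnC.
Qed.

Lemma free_exponent_bot (g : exponent Lam) : free_exponent \bot%O g -> g = [fsfun].
Proof.
move=> [[H _ _] g0]; apply/fsfunP => i; rewrite fsfun0E; apply/eqP/negPn/negP => gi.
by have := H i gi; rewrite lex0 => /eqP e; move: gi; rewrite e g0.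
Qed.

(** Induction on the index: splitting off the power of Q_p with exponent e < alpha_i leaves a factor
    of degree less than deg Q_p, so the total degree is less than (e + 1) deg Q_p, which is at most
    deg Q_i. *)
Lemma small_monomialsP l : nonmax l -> small_monomials l.
Proof.
move: l; apply: (wo_ind wo) => i IH ni.
have IH' p : (p < i)%O -> small_monomials p by move=> pi; apply: (IH p pi); exists i.
have [->|ib] := eqVneq i \bot%O.
  split=> [|g /free_exponent_bot ->]; first by rewrite key_bot size_polyX.
  by rewrite mono0 key_bot size_poly1 size_polyX.
have dg p : step alpha p i -> pdeg (Q i) = (alpha i * pdeg (Q p))%N.
  by move=> st; apply: pdeg_step => //; apply/IH'/(step_lt st).
split.
  have [p st] := step_ex ib; have [s1 _] := IH' p (step_lt st).
  by rewrite size_key_gt1 (dg p st) muln_gt0 key_alpha -size_key_gt1.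
move=> g [sg gi].
have [p [st g0 gb]] := standard_step_ex wo (step_ex ib) sg gi.
pose g' : exponent Lam := [fsfun g with p |-> 0%N].
have g'E q : g' q = if q == p then 0%N else g q by rewrite fsfun_withE.
have [sg' ga] := standard_step_rem wo key_alpha st sg g0 gb g'E.
have g'p : g' p = 0%N by rewrite g'E eqxx.
have := (IH' p (step_lt st)).2 g' (conj sg' g'p).
rewrite (@mono_with _ _ _ Q g' g p (g p)) //; last first.
  by move=> q; rewrite g'E; case: eqP => [->|].
rewrite (size_pdeg (mono_neq0 g')) (size_pdeg (key_neq0 p)) ltnS => lt.
rewrite size_mul ?mono_neq0 ?expf_neq0 ?key_neq0 // size_polyXn_pdeg ?key_neq0 //.
rewrite (size_pdeg (mono_neq0 g')) (size_pdeg (key_neq0 i)) (dg p st) addnS /= ltnS addSn.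
apply: (@leq_trans ((g p).+1 * pdeg (Q p))); last by rewrite leq_mul2r ga orbT.
by rewrite mulSn [X in (_ + X)%N]mulnC -addSn leq_add2r.
Qed.

Lemma size_key l : nonmax l -> (1 < size (Q l))%N.
Proof. by case/small_monomialsP. Qed.

Lemma standard_expansion_qcoef l f n c : nonmax l ->
  standard_expansion nu alpha Q l f n c ->
  forall j, qcoef (Q l) f j = if (j <= n)%N then comb_poly Q (c j) else 0.
Proof.
move=> nl [sc fE]; apply: (qcoef_unique (key_neq0 l) _ fE) => j jn.
by apply: size_comb_poly (sc j jn); apply: small_monomialsP.
Qed.

(** Some monomial attains nu f; otherwise f would be a sum of terms of value larger than nu f. *)
Lemma free_standard_rep l f : f != 0 -> rep nu Q (free_exponent l) (nup f) f ->
  exists2 c, free_standard nu alpha Q l c & comb_poly Q c = f.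
Proof.
move=> nf [c [cP cv cE]]; exists c => //; split=> // _; rewrite cE; split=> //.
have nz g : g \in finsupp c -> (c g)%:P * mono Q g != 0.
  by rewrite mem_finsupp => cg; rewrite mulf_neq0 ?mono_neq0 ?polyC_eq0.
split; last by move=> g gc; apply: nup_ge (cv g gc); apply: nz.
apply: contrapT => H; have : pgt (nup f) f; last by rewrite pgt_irr.
rewrite -{2}cE /comb_poly big_seq; apply: pgt_sum => g gc.
have := nup_ge (nz g gc) (cv g gc); rewrite le_eqVlt => /orP[/eqP e|lt].
  by case: H; exists g; rewrite // -e.
exact: pgt_nup.
Qed.

Lemma free_standard_pge l c : free_standard nu alpha Q l c ->
  forall g, g \in finsupp c -> pge (nup (comb_poly Q c)) ((c g)%:P * mono Q g).
Proof.
move=> [_ H] g gc; have [|_ [_ h]] := H _.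
  by apply/fset0Pn; exists g.
by apply: pge_nup; apply: h.
Qed.

(** * Truncations that compute the value, and existence of standard expansions *)

Definition exact_at p f := forall j, pge (nup f) (qcoef (Q p) f j * Q p ^+ j).

Definition representable l := forall f, f != 0 -> (size f < size (Q l))%N ->
  exists2 c, free_standard nu alpha Q l c & comb_poly Q c = f.

Lemma min_index (P : pred nat) (F : nat -> V) n : (exists2 j, (j <= n)%N & P j) ->
  exists m, [/\ (m <= n)%N, P m & forall j, (j <= n)%N -> P j -> F m <= F j].
Proof.
move=> [j0 j0n Pj0]; have j0n' : (j0 < n.+1)%N by [].
have := @arg_minP _ _ _ (Ordinal j0n') (fun i : 'I_n.+1 => P i) (fun i : 'I_n.+1 => F i) Pj0.
case=> m Pm mm; exists m; split=> //; first by rewrite -ltnS.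
by move=> j; rewrite -ltnS => jn Pj; apply: (mm (Ordinal jn)).
Qed.

Lemma not_exact p f : ~ exact_at p f ->
  exists j, qcoef (Q p) f j != 0 /\ nup (qcoef (Q p) f j * Q p ^+ j) < nup f.
Proof.
move=> /existsNP[j /negP]; rewrite /Defs.nup => h; exists j; split.
  by apply: contraNneq h => ->; rewrite mul0r pge0.
by rewrite ltNge; apply: contra h => /pge_nup.
Qed.

Lemma qcoef_key_eq0 l f j : nonmax l -> (size f <= j)%N -> qcoef (Q l) f j = 0.
Proof.
move=> nl fj; apply: (@qcoef_eq0 _ _ _ (size f)); rewrite ?key_neq0 //.
by rewrite leq_pmulr // -size_key_gt1 size_key.
Qed.

Lemma free_standard0 l : free_standard nu alpha Q l [fsfun].
Proof. by split=> [g|]; rewrite ?in_finsupp0 ?finsupp0 ?eqxx. Qed.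

Lemma comb_poly0 : comb_poly Q [fsfun] = 0.
Proof. by rewrite /comb_poly finsupp0 big_seq_fset0. Qed.

(** Representability supplies a standard expansion; its coefficients are those of the Q_l-expansion,
    so the term of value less than nu f occurs in every standard expansion. *)
Lemma value_jumps_not_exact l f : nonmax l -> representable l -> f != 0 ->
  ~ exact_at l f -> value_jumps nu alpha Q l f.
Proof.
move=> nl rl nf /not_exact[j [nj ltj]]; split.
  have /choice[c cP] : forall j, exists c,
      free_standard nu alpha Q l c /\ comb_poly Q c = qcoef (Q l) f j.
    move=> k.
    have [->|nz] := eqVneq (qcoef (Q l) f k) 0.
      by exists [fsfun]; split; [exact: free_standard0 | exact: comb_poly0].
    by have [|c] := rl _ nz; [rewrite size_qcoef ?key_neq0 | exists c].
  exists (size f), c; split=> [k _|]; first by case: (cP k).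
  rewrite {1}(@qcoef_sum _ (Q l) f (size f).+1) ?size_key //.
    by apply: eq_bigr => k _; rewrite (cP k).2.
  by apply: leq_trans (leqnSn _) _; rewrite leq_pmulr // -size_key_gt1 size_key.
move=> n c ce; have qE := standard_expansion_qcoef nl ce.
have jn : (j <= n)%N by move: nj; rewrite qE; case: leqP => //; rewrite eqxx.
have cj : comb_poly Q (c j) != 0 by move: nj; rewrite qE jn.
have [m [mn cm mm]] := @min_index (fun j => comb_poly Q (c j) != 0)
  (fun j => nup (comb_poly Q (c j) * Q l ^+ j)) n (ex_intro2 _ _ j jn cj).
exists (nup (comb_poly Q (c m) * Q l ^+ m)).
  by split; [exists m | move=> k [kn ck]; apply: mm].
by apply: le_lt_trans ltj; rewrite qE jn mm.
Qed.

Lemma value_jumps_term l f : nonmax l -> value_jumps nu alpha Q l f ->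
  exists j, qcoef (Q l) f j != 0 /\ nup (qcoef (Q l) f j * Q l ^+ j) < nup f.
Proof.
move=> nl [[n [c ce]] H]; have [m [[j [jn cj] <-] _] lt] := H n c ce.
by exists j; rewrite (standard_expansion_qcoef nl ce) jn.
Qed.

(** If no p with p+ = i were exact, f would jump at all of them, and the minimality of deg Q_i would
    give deg Q_i <= deg f. *)
Lemma exact_limit i f : i != \bot%O -> (forall p, ~ is_succ p i) ->
  (forall p, (p < i)%O -> representable p) -> f != 0 -> (pdeg f < pdeg (Q i))%N ->
  exists2 p, step alpha p i & exact_at p f.
Proof.
move=> ib lim rep nf; rewrite ltnNge => /negP df; apply: contrapT => H; apply: df.
have [_ _ H3 _] := klim ib lim; apply: H3 => p /is_plus_step st.
apply: value_jumps_not_exact => //; first exact: nonmax_lt (step_lt st).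
  exact/rep/(step_lt st).
by move=> ex; apply: H; exists p.
Qed.

Lemma representable_bot : representable \bot%O.
Proof.
move=> f nf; rewrite key_bot size_polyX ltnS => /size1_polyC fE.
apply: free_standard_rep => //; rewrite {2}fE -[X in rep _ _ _ _ X]mulr1 -(mono0 Q).
apply: rep_mono; last by rewrite mono0 mulr1 -fE pge_refl.
split; last by rewrite fsfun0E.
split=> [i|i j|i _ j k _ _]; rewrite ?fsfun0E ?eqxx //.
by rewrite ltx0.
Qed.

(** Represent the coefficients of the Q_p-expansion by p-free monomials and multiply them by powers
    of Q_p below alpha_i. Exactness keeps every resulting monomial at value at least nu f. *)
Lemma representable_step p i : nonmax i -> step alpha p i -> representable p ->
  forall f, f != 0 -> (size f < size (Q i))%N -> exact_at p f ->
  exists2 c, free_standard nu alpha Q i c & comb_poly Q c = f.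
Proof.
move=> ni st rp f nf sf ex; apply: free_standard_rep => //.
have np := nonmax_lt (step_lt st).
have dg := pdeg_step ni (small_monomialsP np) st.
rewrite {2}(@qcoef_sum _ (Q p) f (alpha i)) ?size_key //; last first.
  by rewrite -dg -ltnS -size_pdeg ?key_neq0.
apply: rep_sum => k _; have [->|nk] := eqVneq (qcoef (Q p) f k) 0.
  by rewrite mul0r; exact: rep0.
have [|c cf cE] := rp _ nk; first by rewrite size_qcoef ?key_neq0.
have kv : nup f <= nup (qcoef (Q p) f k) + nup (Q p ^+ k).
  by rewrite -nupM ?expf_neq0 ?key_neq0 // nup_ge // mulf_neq0 ?expf_neq0 ?key_neq0.
rewrite -{1}cE /comb_poly mulr_suml; apply: rep_sum => g gc.
have [sg gp] := cf.1 g gc.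
pose g' : exponent Lam := [fsfun g with p |-> k : nat].
have g'E q : g' q = if q == p then k : nat else g q by rewrite fsfun_withE.
rewrite -mulrA -(mono_with Q gp g'E); apply: rep_mono.
  split; first exact: (standard_step_add wo key_alpha st sg (ltn_ord k) g'E).
  rewrite g'E ifN; last by rewrite gt_eqF // (step_lt st).
  apply/eqP/negPn/negP => gi; have [H _ _] := sg.
  by have := H i gi; rewrite leNgt (step_lt st).
rewrite (mono_with Q gp g'E) mulrA; apply: pge_trans kv _.
by apply: pgeM; rewrite ?pge_refl // -cE; exact: (free_standard_pge cf gc).
Qed.

(** In degree nu f only the monomials of least value survive, and their initial forms are products
    of the generators. *)
Lemma graded_sub_initial l f : representable l -> f != 0 -> (size f < size (Q l))%N ->
  graded_sub Q l (initial nu (tofrac f)).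
Proof.
move=> rl nf sf; have [c cf cE] := rl f nf sf.
have vg (g : exponent Lam) : g \in finsupp c ->
    tofrac ((c g)%:P * mono Q g) \in val_ge nu (nup f).
  by move=> gc; rewrite -pgeE -cE; exact: (free_standard_pge cf gc).
rewrite -[initial _ _]/(gr_class nu (nup f) _) -{2}cE /comb_poly rmorph_sum big_seq /=.
rewrite gr_class_sum //; apply: generated_subring_sum => g gc.
rewrite gr_class_initial ?vg //; case: ifP => _; last exact: generated_subring0.
have nc : c g != 0 by rewrite -mem_finsupp.
rewrite rmorphM initialM ?tofrac_eq0 ?mono_neq0 ?polyC_eq0 //.
apply: generated_subringM; first by apply: generated_subringI; left; exists (c g).
have [[H _ _] gl] := cf.1 g gc.
have -> : initial nu (tofrac (mono Q g)) = \prod_(q <- finsupp g) initial nu (tofrac (Q q)) ^+ g q.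
  rewrite /mono; elim: (finsupp g : seq _) => [|q r IH].
    by rewrite !big_nil rmorph1 initial1.
  rewrite !big_cons rmorphM initialM ?tofrac_eq0 ?expf_neq0 ?key_neq0 //.
    by rewrite IH rmorphXn initialX ?tofrac_eq0 ?key_neq0.
  by apply/monic_neq0/monic_prod => ? _; rewrite monic_exp ?key_monic.
rewrite big_seq; apply: generated_subring_prod => q; rewrite mem_finsupp => gq.
apply: generated_subringX; apply: generated_subringI; right; exists q => //.
by rewrite lt_neqAle H // andbT; apply: contraNneq gq => ->; rewrite gl.
Qed.

Lemma size_initial_relation a (c : nat -> combination K Lam) :
  (a < size (initial_relation nu Q a c))%N.
Proof.
rewrite ltnNge; apply/negP => /leq_sizeP/(_ a (leqnn _)).
rewrite /initial_relation coefD coefXn eqxx coef_sum big1 ?addr0.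
  by move/eqP; rewrite oner_eq0.
move=> j _; rewrite coefMXn ltnNge ltnW //= coefC subn_eq0 leqNgt ltn_ord //.
Qed.

(** If the least value of a term were below nu f, the initial forms of the least terms would cancel,
    giving a relation for the initial form of Q_p of degree less than alpha_i. *)
Lemma exact_succ p i f : is_succ p i -> representable p -> f != 0 ->
  (pdeg f < pdeg (Q i))%N -> nonmax i -> exact_at p f.
Proof.
move=> s rp nf df ni; apply: contrapT => /not_exact[j0 [nj0 lt0]].
have np : nonmax p by apply: nonmax_lt s.1.
have dg := pdeg_step ni (small_monomialsP np) (or_introl s).
have sfa : (size f <= alpha i * pdeg (Q p))%N by rewrite -dg size_pdeg.
have [c [_ _ _ [_ _ _ minR]]] := ksucc s.
set a := alpha i in dg sfa minR; set d := qcoef (Q p) f in nj0 lt0.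
have lta j : d j != 0 -> (j < a)%N.
  by move=> nd; rewrite ltnNge; apply: contraNN nd => aj; rewrite /d (qcoef_eq0 _ sfa) ?key_neq0.
pose F j := nup (d j * Q p ^+ j).
have [m [_ nm mm]] := @min_index (fun j => d j != 0) F j0 (ex_intro2 _ _ j0 (leqnn _) nj0).
have [k [ka nk kk]] := @min_index (fun j => d j != 0) F a (ex_intro2 _ _ j0 (ltnW (lta _ nj0)) nj0).
have kmin j : d j != 0 -> F k <= F j by move=> nj; apply: kk => //; exact/ltnW/lta.
have ltk : F k < nup f by apply: le_lt_trans lt0; apply: kmin.
have dge j : tofrac (d j * Q p ^+ j) \in val_ge nu (F k).
  rewrite -pgeE; have [->|nd] := eqVneq (d j) 0; first by rewrite mul0r pge0.
  by apply/pge_nup/kmin.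
(* R collects the coefficients of the terms of least value F k; its size is at most alpha_i. *)
pose r j := if (d j != 0) && (F j == F k) then initial nu (tofrac (d j)) else 0.
pose R := \poly_(j < a) r j : {poly graded_alg nu}.
have Rk : R`_k != 0.
  by rewrite coef_poly lta // /r nk eqxx initial_neq0 // tofrac_eq0.
have nR : R != 0 by apply: contraNneq Rk => ->; rewrite coef0.
have := size_initial_relation a c; rewrite ltnNge => /negP; apply.
apply: leq_trans (size_poly a r); apply: minR => // [j|].
  have G1 : graded_sub Q p (1 : graded_alg nu) by exact: generated_subring1.
  have G0 : graded_sub Q p (0 : graded_alg nu) by exact: generated_subring0.
  rewrite coef_poly; case: ifP => _; last exact: (sub_star G1 G0).
  rewrite /r; case: ifP => [/andP[nj _]|_]; last exact: (sub_star G1 G0).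
  by apply: (sub_star G1); apply: graded_sub_initial; rewrite // size_qcoef ?key_neq0.
apply/rootP; rewrite horner_poly.
have -> : \sum_(j < a) r j * initial nu (tofrac (Q p)) ^+ j =
    gr_class nu (F k) (tofrac f).
  rewrite [in RHS](qcoef_sum (size_key np) sfa) rmorph_sum.
  rewrite (gr_class_sum _ (F := fun j : 'I_a => tofrac (d j * Q p ^+ j))) //.
  apply: eq_bigr => j _; rewrite -/(d j) (gr_class_initial (dge j)).
  rewrite tofrac_eq0 mulf_eq0 expf_eq0 (negPf (key_neq0 p)) andbF orbF /r -[nu _]/(F j).
  have nQ : tofrac (Q p) != 0 by rewrite tofrac_eq0 key_neq0.
  have [/andP[nj _]|_] := boolP ((d j != 0) && (F j == F k)); last exact: mul0r.
  have nt : tofrac (d j) != 0 by rewrite tofrac_eq0.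
  rewrite rmorphM rmorphXn (initialM nu nt (expf_neq0 j nQ)) (initialX nu j nQ).
  by [].
(* R evaluated at the initial form of Q_p is the class of f in degree F k, which is zero because F k
   < nu f. *)
apply/eqP; rewrite gr_class_eq0 ?inE ?tofrac_eq0 ?(negPf nf) //=.
by rewrite ltW.
Qed.

Lemma representableP l : nonmax l -> representable l.
Proof.
move: l; apply: (wo_ind wo) => i IH ni.
have IH' p : (p < i)%O -> representable p by move=> pi; apply: (IH p pi); exists i.
have [->|ib] := eqVneq i \bot%O; first exact: representable_bot.
move=> f nf sf; have df : (pdeg f < pdeg (Q i))%N by rewrite -ltnS -!size_pdeg ?key_neq0.
have [p st ex] : exists2 p, step alpha p i & exact_at p f.
  have [[p s]|lim] := pselect (exists p, is_succ p i).
    by exists p; [left | apply: (exact_succ s) => //; apply: (IH' p s.1)].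
  by apply: exact_limit => // p s; apply: lim; exists p.
by apply: (representable_step ni st) => //; apply/IH'/(step_lt st).
Qed.

Hypothesis hx : 0 < nup 'X.
Hypothesis kval : key_values nu Q.

Local Notation Gam := (Gam0Q nu).

Lemma Gam0 : Gam 0. Proof. exact: (rational_hull0 (nuK nu)). Qed.
Lemma GamD u v : Gam u -> Gam v -> Gam (u + v).
Proof. exact: (rational_hullD (nu := nuK nu)). Qed.
Lemma GamMn v n : Gam v -> Gam (v *+ n).
Proof. exact: (rational_hullMn (nu := nuK nu)). Qed.
Lemma Gam_max u v : Gam u -> Gam v -> Gam (Order.max u v).
Proof. exact: (rational_hull_max (nu := nuK nu)). Qed.

(** This supplies the constant needed by [pge_cge] to compare nu with the Gauss valuation in degrees
    below deg Q_l. *)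
Definition bounded_monic l := exists C, [/\ Gam C, 0 <= C &
  forall f, f \is monic -> (size f < size (Q l))%N -> nup f <= C].

(** * Omega-sequences of key polynomials of constant degree and unbounded value *)

Section OmegaSequence.
Variables (s i : Lam).
Hypothesis om : is_plus_omega s i.
Hypothesis alpha1 : forall t, alpha (shift s t) = 1%N.
Hypothesis bs : bounded_monic s.
Hypothesis unbounded : forall v, Gam v -> exists t, v < nup (Q (shift s t)).

Local Notation Qs t := (Q (shift s t)).

Lemma nonmax_shift t : nonmax (shift s t).
Proof. exact: nonmax_lt (plus_omega_lt om t). Qed.

Lemma size_shift t : size (Qs t) = size (Q s).
Proof.
elim: t => [//|t IH]; rewrite -IH !size_pdeg ?key_neq0 //.
rewrite (@pdeg_step (shift s t)) ?alpha1 ?mul1n //; first exact: nonmax_shift.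
  exact/small_monomialsP/nonmax_shift.
left; exact: (plus_omega_succ wo om).
Qed.

(** For a fixed t0 the difference of the two monic polynomials has smaller degree and nonnegative
    value, so [pge_cge] bounds its coefficients uniformly in t. *)
Lemma cge_shift : exists C, [/\ Gam C, 0 <= C &
  forall t, 0 <= nup (Qs t) -> cge nu (- C) (Qs t)].
Proof.
have [C [GC C0 HC]] := bs; have [t0 lt0] := unbounded Gam0.
have [D [GD D0 HD]] := cge_ex nu (Qs t0).
pose n := (size (Q s)).-1.
exists (Order.max D (C *+ n)); split; first exact/Gam_max/GamMn.
  by rewrite le_max D0.
move=> t tpos; rewrite -[Qs t](subrK (Qs t0)); apply: cgeD; last first.
  by apply: cge_trans HD; rewrite ord_leNl opprK le_max lexx.
have le : - Order.max D (C *+ n) <= 0 - C *+ n.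
  by rewrite add0r ord_leNl opprK le_max lexx orbT.
have sn f : (size f <= n)%N = (size f < size (Q s))%N.
  by rewrite /n -ltnS prednK // size_poly_gt0 key_neq0.
apply: (cge_trans le); apply: (pge_cge hx C0 (n := n)) => //.
- by move=> f mf; rewrite sn => /(HC f mf).
- rewrite sn ltnNge; apply/negP => ge.
  have sz : (size (Qs t - Qs t0)%R <= size (Q s))%N.
    by rewrite (leq_trans (size_polyD _ _)) // size_polyN !size_shift maxnn.
  have es : size (Qs t - Qs t0)%R = size (Q s) by apply/eqP; rewrite eqn_leq sz.
  have : lead_coef (Qs t - Qs t0) == 0.
    rewrite lead_coefE es coefB -{1}(size_shift t) -(size_shift t0) -!lead_coefE.
    by rewrite !(eqP (key_monic _)) subrr.
  by rewrite lead_coef_eq0 -size_poly_eq0 es size_poly_eq0 (negPf (key_neq0 s)).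
by apply: pgeB; apply: pge_nup => //; exact: ltW.
Qed.

Lemma pge_qcoef_shift f : exists D, [/\ Gam D, 0 <= D &
  forall t, 0 <= nup (Qs t) -> forall j, pge (- D) (qcoef (Qs t) f j)].
Proof.
have [C [GC C0 HC]] := cge_shift; have [D [GD D0 HD]] := cge_ex nu f.
(* Only coefficients of index j < N can be nonzero, so the loss C N (j + 1) is at most C N^2. *)
pose N := size f; exists (D + C *+ (N * N)); split.
- by apply: GamD => //; apply: GamMn.
- by rewrite -[X in X <= _]addr0 ord_leD // ord_mulrn_ge0.
move=> t t0 j; have [lt|ge] := ltnP j N; last first.
  by rewrite qcoef_key_eq0 ?pge0 //; apply: nonmax_shift.
apply: (cge_pge hx); apply: cge_trans (cge_qcoef j (key_monic _) C0 (HC t t0) (leqnn N) HD).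
by rewrite opprD ord_leD2lE ord_leNl opprK ord_mulrn_le // leq_mul2l lt orbT.
Qed.

Lemma nup_qcoef_shift f : f != 0 -> Gam (nup f) -> exists v, [/\ Gam v, 0 <= v &
  forall t, v < nup (Qs t) ->
    [/\ qcoef (Qs t) f 0 != 0, nup (qcoef (Qs t) f 0) = nup f &
        forall j, (0 < j)%N -> pgt (nup f) (qcoef (Qs t) f j * Qs t ^+ j)]].
Proof.
move=> nf Gf; have [D [GD D0 HD]] := pge_qcoef_shift f.
(* Beyond this threshold, each term of index j >= 1 has value at least - D + j beta_(s+t) > nu f. *)
exists (Order.max 0 (nup f + D)); split; first exact/(Gam_max Gam0)/GamD.
  by rewrite le_max lexx.
move=> t; rewrite gt_max => /andP[t0 tf].
have H j : (0 < j)%N -> pgt (nup f) (qcoef (Qs t) f j * Qs t ^+ j).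
  case: j => // j _; apply: (@pge_gt _ _ _ _ (- D + nup (Qs t) *+ j.+1)).
    apply: lt_le_trans (_ : - D + nup (Qs t) <= _).
      by rewrite addrC ord_ltbl opprK.
    by rewrite ord_leD2lE ord_mulrn_leS // ltW.
  by apply: pgeM; [apply: HD; exact: ltW | rewrite -nupX ?key_neq0 // pge_refl].
have fE : f = qcoef (Qs t) f 0 + \sum_(j < size f) qcoef (Qs t) f j.+1 * Qs t ^+ j.+1.
  rewrite {1}(@qcoef_sum _ (Qs t) f (size f).+1) ?(size_key (nonmax_shift t)) //.
    by rewrite big_ord_recl expr0 mulr1.
  apply: leq_trans (leqnSn _) _; rewrite leq_pmulr // -size_key_gt1.
  exact/size_key/nonmax_shift.
set S := \sum_(j < _) _ in fE.
have HS : pgt (nup f) (- S) by rewrite pgtN; apply: pgt_sum => j _; apply: H.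
have e0 : qcoef (Qs t) f 0 = f - S by rewrite {2}fE addrK.
by have [] := nup_addr_pgt nf HS; rewrite -e0.
Qed.

(** A rational nu f would be passed by some beta_(s+t); then no term of that expansion lies below nu
    f, so f does not jump there. *)
Lemma value_jumps_irrational f : f != 0 ->
  (forall t, value_jumps nu alpha Q (shift s t) f) -> ~ Gam (nup f).
Proof.
move=> nf J Gf; have [v [Gv _ H]] := nup_qcoef_shift nf Gf.
have [t /H[n0 e0 Hj]] := unbounded Gv.
have [j [nj]] := value_jumps_term (@nonmax_shift t) (J t).
case: j nj => [|j] nj; first by rewrite expr0 mulr1 e0 ltxx.
have := nup_gt _ (Hj j.+1 isT); rewrite mulf_neq0 ?expf_neq0 ?key_neq0 // => /(_ isT).
by move=> /lt_trans h /h; rewrite ltxx.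
Qed.

End OmegaSequence.

(** Exactness bounds nu f above by the value of any nonzero term. The top term has a monic
    coefficient of degree less than deg Q_p and an exponent less than a. *)
Lemma exact_bound p f C B a : nonmax p -> f \is monic -> exact_at p f -> 0 <= C ->
  (forall g, g \is monic -> (size g < size (Q p))%N -> nup g <= C) ->
  0 <= B -> nup (Q p) <= B -> (size f <= a * pdeg (Q p))%N -> nup f <= C + B *+ a.
Proof.
move=> np mf ex C0 HC B0 HB sf; set J := (pdeg f %/ pdeg (Q p))%N.
have mJ : qcoef (Q p) f J \is monic by rewrite qcoef_top_monic ?size_key ?key_monic.
have nJ := monic_neq0 mJ.
have Ja : (J < a)%N.
  by rewrite ltnNge; apply: contraNN nJ => aJ; rewrite (qcoef_eq0 _ sf) ?key_neq0.
apply: le_trans (nup_ge _ (ex J)) _; first by rewrite mulf_neq0 ?expf_neq0 ?key_neq0.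
rewrite nupM ?expf_neq0 ?key_neq0 // nupX ?key_neq0 //; apply: ord_leD.
  by apply: HC => //; rewrite size_qcoef ?key_neq0.
by apply: le_trans (ord_mulrn_le2 J HB) _; rewrite ord_mulrn_le // ltnW.
Qed.

Lemma step_plus_omega p i : (forall q, ~ is_succ q i) -> step alpha p i ->
  is_plus_omega p i /\ forall t, alpha (shift p t) = 1%N.
Proof. by move=> lim [/(lim p)|]. Qed.

Lemma limit_value_jumps p i : i != \bot%O -> (forall q, ~ is_succ q i) ->
  step alpha p i -> value_jumps nu alpha Q p (Q i).
Proof.
by move=> ib lim st; have [_ H _ _] := klim ib lim; case: (H p (step_limit_plus lim st)).
Qed.

Lemma bounded_monicP l : nonmax l -> bounded_monic l.
Proof.
move: l; apply: (wo_ind wo) => i IH ni.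
have IH' p : (p < i)%O -> bounded_monic p by move=> pi; apply: (IH p pi); exists i.
have [->|ib] := eqVneq i \bot%O.
  exists 0; split=> [||f mf]; [exact: Gam0 | exact: lexx |].
  rewrite key_bot size_polyX ltnS => /size1_polyC fE.
  by move: mf; rewrite fE monicE lead_coefC => /eqP ->; rewrite nup1.
have sf p f : step alpha p i -> (size f < size (Q i))%N -> (size f <= alpha i * pdeg (Q p))%N.
  move=> st; rewrite -(pdeg_step ni _ st) ?[size (Q i)]size_pdeg ?key_neq0 //.
  exact/small_monomialsP/(nonmax_lt (step_lt st)).
have df f : f \is monic -> (size f < size (Q i))%N -> (pdeg f < pdeg (Q i))%N.
  by move=> mf; rewrite !size_pdeg ?key_neq0 ?monic_neq0.
have [[p s]|lim0] := pselect (exists p, is_succ p i).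
  have pi := s.1; have [C [GC C0 HC]] := IH' p pi.
  have Gp : Gam (nup (Q p)) by apply: kval; exists i.
  exists (C + Order.max 0 (nup (Q p)) *+ alpha i); split.
  - by apply/GamD/GamMn/Gam_max => //; exact: Gam0.
  - by rewrite -[X in X <= _]addr0 ord_leD // ord_mulrn_ge0 // le_max lexx.
  move=> f mf sfi; apply: (exact_bound (p := p)) => //.
  - exact: nonmax_lt pi.
  - apply: (exact_succ s) => //; [|exact: monic_neq0 | exact: df].
    exact/representableP/(nonmax_lt pi).
  - by rewrite le_max lexx.
  - by rewrite le_max lexx orbT.
  by apply: sf => //; left.
have lim q : ~ is_succ q i by move=> sq; apply: lim0; exists q.
(* With p least, every q with q+ = i is some p + t, so one bound C for degrees below deg Q_p serves
   all of them. *)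
have [p st pm] := wo_min wo (step_ex ib).
have [om a1] := step_plus_omega lim st.
have [C [GC C0 HC]] := IH' p (step_lt st).
(* Were the values unbounded, nu Q_i would be irrational, which is excluded because i is not
   maximal. *)
have [B [GB B0 HB]] : exists B, [/\ Gam B, 0 <= B & forall t, nup (Q (shift p t)) <= B].
  apply: contrapT => H; apply: (value_jumps_irrational om a1 (IH' p (step_lt st)) _ (key_neq0 i)).
  - move=> v Gv; apply: contrapT => Hv; apply: H; exists (Order.max 0 v); split.
    + by apply: Gam_max => //; exact: Gam0.
    + by rewrite le_max lexx.
    move=> t; rewrite le_max; apply/orP; right; rewrite leNgt; apply/negP => lt.
    by apply: Hv; exists t.
  - move=> t; apply: limit_value_jumps => //; right; split.
      exact: (plus_omega_shift wo om).
    by move=> u; rewrite shift_shift.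
  exact: kval.
exists (C + B *+ alpha i); split.
- by apply/GamD/GamMn.
- by rewrite -[X in X <= _]addr0 ord_leD // ord_mulrn_ge0.
move=> f mf sfi.
have [q stq ex] : exists2 p, step alpha p i & exact_at p f.
  apply: exact_limit => //; [|exact: monic_neq0 | exact: df].
  by move=> q qi; apply: representableP; exists i.
have [t qE] := plus_omega_below wo om (pm q stq) (step_lt stq).
apply: (exact_bound (p := q)) => //; rewrite ?qE //.
- exact: nonmax_shift om _.
- by move=> g mg; rewrite (size_shift om a1); apply: HC.
by rewrite -qE; apply: sf.
Qed.

(** * Linear key polynomials and Hasse derivatives *)

Section LinearSequence.
Variable i : Lam.
Hypothesis om : is_plus_omega \bot%O i.
Hypothesis alpha1 : forall t, alpha (shift \bot%O t) = 1%N.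
Hypothesis unbounded : forall v, Gam v -> exists t, v < nup (Q (shift \bot%O t)).

Local Notation Qs t := (Q (shift \bot%O t)).

Lemma linear_shift t : exists a, Qs t = 'X - a%:P.
Proof.
have sz : size (Qs t) = 2%N by rewrite (size_shift om alpha1) key_bot size_polyX.
exists (- (Qs t)`_0); apply/polyP => -[|[|k]].
- by rewrite coefB coefX coefC sub0r opprK.
- by rewrite coefB coefX coefC subr0 -(eqP (key_monic (shift \bot%O t))) lead_coefE sz.
by rewrite coefB coefX coefC subr0 nth_default ?sz.
Qed.

Lemma unbounded_tail T v : Gam v -> exists2 t, (T <= t)%N & v < nup (Qs t).
Proof.
elim: T v => [|T IH] v Gv; first by have [t lt] := unbounded Gv; exists t.
have GT : Gam (nup (Qs T)) by apply: kval; exists i; apply: plus_omega_lt om T.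
have [t Tt] := IH _ (Gam_max Gv GT); rewrite gt_max => /andP[vt lt]; exists t => //.
by rewrite ltn_neqAle Tt andbT; apply: contraTneq lt => ->; rewrite ltxx.
Qed.

(** Some linear Q_p is exact for f, so nu f is the value of a constant times a power of Q_p. *)
Lemma nup_lower_degree f : f != 0 -> (pdeg f < pdeg (Q i))%N -> Gam (nup f).
Proof.
move=> nf df; have ib : i != \bot%O by rewrite gt_eqF // (plus_omega_lt om 0).
have lim q : ~ is_succ q i by exact: (plus_omega_limit wo om).
have rep p : (p < i)%O -> representable p by move=> pi; apply: representableP; exists i.
have [p st ex] := exact_limit ib lim rep nf df.
have [t pE] := plus_omega_below wo om (le0x p) (step_lt st).
have np : nonmax p := nonmax_lt (step_lt st).
have [j [nj e]] : exists j, qcoef (Q p) f j != 0 /\ nup (qcoef (Q p) f j * Q p ^+ j) = nup f.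
  apply: contrapT => H; have : pgt (nup f) f; last by rewrite pgt_irr.
  rewrite {2}(@qcoef_sum _ (Q p) f (size f)) ?size_key //; last first.
    by rewrite leq_pmulr // -size_key_gt1 size_key.
  apply: pgt_sum => j _; have [->|nj] := eqVneq (qcoef (Q p) f j) 0.
    by rewrite mul0r pgt0.
  apply: pgt_nup; rewrite lt_neqAle (nup_ge _ (ex j)) ?mulf_neq0 ?expf_neq0 ?key_neq0 //.
  by rewrite andbT; apply/eqP => e; apply: H; exists j.
rewrite -e nupM ?expf_neq0 ?key_neq0 // nupX ?key_neq0 //; apply: GamD.
  have [a Qa] := linear_shift t; move: nj; rewrite pE Qa qcoef_taylor polyC_eq0.
  exact: Gam0Q_const.
by apply/GamMn/kval.
Qed.

(** With Q_t = x - a_t, the b-th coefficient for Q_i is also the constant term in the expansion of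
    the b-th Hasse derivative, which has smaller degree and hence rational value. *)
Lemma nup_nderivn b : (0 < b)%N -> (Q i)^`N(b) != 0 ->
  exists v, [/\ Gam v, Gam (nup (Q i)^`N(b)) & forall t, v < nup (Qs t) ->
    qcoef (Qs t) (Q i) b != 0 /\ nup (qcoef (Qs t) (Q i) b) = nup (Q i)^`N(b)].
Proof.
move=> b0 nb.
have Gb : Gam (nup (Q i)^`N(b)).
  apply: nup_lower_degree => //; rewrite -ltnS -!size_pdeg ?key_neq0 //.
  have si : (0 < size (Q i))%N by rewrite size_poly_gt0 key_neq0.
  rewrite -(prednK si) ltnS; apply/leq_sizeP => k sk.
  rewrite coef_nderivn nth_default ?mul0rn //.
  by rewrite -(prednK si) -add1n leq_add.
have bb : bounded_monic \bot%O by apply: bounded_monicP; exists i; apply: (plus_omega_lt om 0).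
have [v [Gv _ H]] := nup_qcoef_shift om alpha1 bb unbounded nb Gb.
exists v; split=> // t /H[]; have [a ->] := linear_shift t.
by rewrite !qcoef_taylor nderivn0.
Qed.

(* For large t the delta-invariant is the least b >= 1 whose Hasse derivative does not
   vanish, since the b-th coefficient of the expansion has the value of that derivative. *)
Lemma stable_delta d : ~ Gam (nup (Q i)) ->
  (exists T, forall t, (T <= t)%N -> trunc_delta nu (Qs t) (Q i) d) ->
  [/\ (0 < d)%N, (Q i)^`N(d) != 0 & forall b, (0 < b < d)%N -> (Q i)^`N(b) = 0].
Proof.
move=> irr [T HT].
have d0 : (0 < d)%N.
  (* If d = 0, the constant term alone has the least value, so nu Q_i would be the value of an
     element of K. *)
  case: posnP => // e0; have [[n0 [_ min]] mx] := HT T (leqnn T); case: irr.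
  have [a Qa] := linear_shift T; rewrite e0 in n0 min mx.
  move: n0 min mx; set f := Q i; set q := qcoef (Qs T) f => n0 min mx.
  have nT : nonmax (shift \bot%O T) := nonmax_lt (plus_omega_lt om T).
  have fE : f = q 0%N + \sum_(j < size f) q j.+1 * Qs T ^+ j.+1.
    rewrite {1}(@qcoef_sum _ (Qs T) f (size f).+1) ?(size_key nT) //.
      by rewrite big_ord_recl expr0 mulr1.
    by apply: leq_trans (leqnSn _) _; rewrite leq_pmulr // -size_key_gt1 size_key.
  have gt : pgt (nup (q 0%N)) (\sum_(j < size f) q j.+1 * Qs T ^+ j.+1).
    apply: pgt_sum => j _; have [->|nj] := eqVneq (q j.+1) 0; first by rewrite mul0r pgt0.
    apply: pgt_nup; rewrite nupM ?expf_neq0 ?key_neq0 // nupX ?key_neq0 //.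
    have := min j.+1 nj; rewrite mulr0n addr0 le_eqVlt => /orP[/eqP e|//].
    have // : (j.+1 <= 0)%N.
    apply: mx; split=> //; rewrite -e; split; last by move=> k /min; rewrite mulr0n addr0.
    by exists 0%N; rewrite // mulr0n addr0.
  have [_] := nup_addr_pgt n0 gt; rewrite -fE => ->.
  move: n0; rewrite /q Qa qcoef_taylor polyC_eq0; exact: Gam0Q_const.
have nd : (Q i)^`N(d) != 0.
  have [[nd _] _] := HT T (leqnn T); have [a Qa] := linear_shift T.
  by apply: contraNneq nd => e; rewrite Qa qcoef_taylor e horner0.
split=> // b /andP[b0 bd]; apply/eqP/negPn/negP => nb.
have [v [Gv Gb Hv]] := nup_nderivn b0 nb; have [w [Gw Gd Hw]] := nup_nderivn d0 nd.
set x := nup (Q i)^`N(b) in Gb Hv; set y := nup (Q i)^`N(d) in Gd Hw.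
have Gxy : Gam (x - y) by apply: GamD => //; exact: (rational_hullN (nu := nuK nu)).
(* Once beta_t exceeds both 0 and x - y, the term of index b < d is smaller than the one of index d,
   which contradicts that d attains the minimum. *)
have [t Tt] := unbounded_tail T (Gam_max (Gam_max Gv Gw) (Gam_max Gam0 Gxy)).
rewrite !gt_max => /andP[/andP[/Hv[nqb eb] /Hw[nqd ed]] /andP[tpos txy]].
have [[_ [_ min]] _] := HT t Tt; have := min b nqb; rewrite eb ed leNgt; case/negP.
rewrite -(subnK (ltnW bd)) mulrnDr addrA ord_ltD2rE.
rewrite [y + _]addrC ord_ltbl; apply: lt_le_trans txy _.
by rewrite -(prednK (_ : 0 < d - b)%N) ?subn_gt0 // ord_mulrn_leS // ltW.
Qed.

End LinearSequence.

End KeyPolynomialTheory.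

Theorem mainTheorem6 (K : fieldType) (V : orderedQSpace)
    (nu : valuation {fraction {poly K}} V)
    (hV : spanned_by_values nu)
    (hrank : rank_one (nuK nu))
    (hx : 0 < nup nu 'X)
    (disp : Order.disp_t) (Lam : bOrderType disp)
    (alpha : Lam -> nat) (Q : Lam -> {poly K})
    (hkey : key_polynomials nu alpha Q)
    (hcomplete : complete nu Q)
    (l lw : Lam)
    (hlw : is_plus_omega l lw)
    (halpha : forall t : nat, (0 < t)%N -> alpha (shift l t) = 1%N)
    (delta : nat)
    (hdelta : exists T : nat, forall t : nat, (T <= t)%N ->
       trunc_delta nu (Q (shift l t)) (Q lw) delta)
    (hunbounded : ~ bounded_in (Gam0Q nu)
       [set nup nu (Q (shift l t)) | t in [set t : nat | (0 < t)%N]]) :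
  ~ Gam0Q nu (nup nu (Q lw)) /\
  ([pchar residue_field nu] =i [pchar K] ->
   l = lsucc \bot%O ->
   (forall t : nat, (0 < t)%N -> alpha (shift \bot%O t) = 1%N) ->
   (exists g : {poly K}, Q lw = g \Po 'X^delta) /\
   (forall b : nat, (0 < b < delta)%N -> (Q lw)^`N(b) = 0)).
Proof.
have [_ wo [prekey kval ksucc klim _]] := hkey.
(* The sequence is started at l + 1, because alpha_l itself need not be 1. *)
have sl t : shift l t.+1 = shift (shift l 1) t by rewrite shift_shift // addn1.
have a1 t : alpha (shift (shift l 1) t) = 1%N by rewrite -sl halpha.
have om := plus_omega_shift wo hlw 1.
have lwb : lw != \bot%O by rewrite gt_eqF // (le_lt_trans (le0x l)) // (plus_omega_lt hlw 0).
have lim p : ~ is_succ p lw by exact: (plus_omega_limit wo hlw).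
have unb v : Gam0Q nu v -> exists t, v < nup nu (Q (shift (shift l 1) t)).
  move=> Gv; apply: contrapT => H; apply: hunbounded; exists v => // b [[//|t] _ <-].
  by rewrite leNgt; apply/negP => lt; apply: H; exists t; rewrite -sl.
have irr : ~ Gam0Q nu (nup nu (Q lw)).
  apply: (value_jumps_irrational wo prekey ksucc klim hx om a1 _ unb).
  - apply: (bounded_monicP wo prekey ksucc klim hx kval).
    exact: nonmax_lt (plus_omega_lt om 0).
  - exact: (key_neq0 prekey).
  move=> t; apply: (limit_value_jumps klim) => //.
  right; split; first exact: (plus_omega_shift wo om).
  by move=> u; rewrite shift_shift.
split=> // _ lE a0.
have ltb : (\bot < lw)%O by rewrite lt0x.
(* As l = 1 and alpha_0 = 1, the sequence can be started at index 0, where Q_0 = x makes all its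
   members linear. *)
have om0 : is_plus_omega \bot%O lw by apply: plus_omega_lsucc => //; rewrite -lE.
have s0 t : shift l t = shift \bot%O t.+1 by rewrite lE /shift iterSr.
have a0' t : alpha (shift \bot%O t) = 1%N.
  by case: t => [|t]; [case: prekey => _ _ [] | apply: a0].
have unb0 v : Gam0Q nu v -> exists t, v < nup nu (Q (shift \bot%O t)).
  by move=> /unb[t lt]; exists t.+2; rewrite -s0 sl.
have [|d0 nd dz] := stable_delta wo prekey ksucc klim hx kval om0 a0' unb0 (d := delta) irr.
  (* The threshold grows by one because l + t is the index t + 1 counted from 0. *)
  by have [T HT] := hdelta; exists T.+1 => -[//|t] Tt; rewrite -s0; apply: HT.
by split=> //; apply: comp_polyXn_nderivn.
Qed.
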